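(* Let $f=\tfrac45$ and let $\pi\colon\mathbb{R}\to\mathbb{R}$ be the explicit function, periodic modulo $1$, defined in the context. Then $\pi$ is a two-sided discontinuous piecewise linear function (with some irrational breakpoints) that is not extreme (nor a facet), but is a weak facet.
   Context: Fix $f=\tfrac45$. Let $\mathcal{Y}$ be the set of finite-support functions $y\colon\mathbb{R}\to\mathbb{Z}_{\ge 0}$ with $\sum_{r\in\mathbb{R}} r\,y(r)\equiv f \pmod 1$ (i.e. the difference is an integer). A function $\pi\colon\mathbb{R}\to\mathbb{R}$ is a valid function if $\pi\ge 0$ and $\sum_{r\in\mathbb{R}}\pi(r)y(r)\ge 1$ for all $y\in\mathcal{Y}$. For a valid function $\pi$, let $P(\pi)=\{\,y\in\mathcal{Y} : \sum_{r}\pi(r)y(r)=1\,\}$. A valid function $\pi$ is extreme if whenever $\pi=\tfrac12(\pi^1+\pi^2)$ with $\pi^1,\pi^2$ valid, then $\pi=\pi^1=\pi^2$. It is a facet if for every valid $\pi'$ with $P(\pi)\subseteq P(\pi')$ we have $\pi'=\pi$. It is a weak facet if for every valid $\pi'$ with $P(\pi)\subseteq P(\pi')$ we have $P(\pi)=P(\pi')$. A function is piecewise linear if there is a locally finite collection of closed proper intervals covering $\mathbb{R}$, any two distinct ones intersecting at most in a common endpoint, such that the function is affine on the interior of each interval; the endpoints are the breakpoints. Two-sided discontinuous means discontinuous at the origin from both sides. Definition of the function $\pi$. Let $c_1=\frac{35}{13}$, $c_2=\frac{5}{11999}$, $c_3=-5$. Below, for each $i=0,\dots,18$ we list the breakpoint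 $x_i$, the value $\pi(x_i)$, the right limit $\pi(x_i^+)$, and the slope of $\pi$ on the open interval $(x_i,x_{i+1})$, where $x_{19}=\frac{371}{800}$. On $(x_i,x_{i+1})$ the function is $\pi(x)=\pi(x_i^+)+\text{slope}\cdot(x-x_i)$. - $i=0$: $x_0=0$; value $0$; right limit $\frac{101}{650}$; slope $c_3$. - $i=1$: $x_1=\frac{101}{5000}$; value $\frac{2727}{13000}$; right limit $\frac{707}{13000}$; slope $c_1$. - $i=2$: $x_2=\frac{60153}{369200}$; value and right limit $\frac{421071}{959920}$; slope $c_3$. - $i=3$: $x_3=\frac{849}{5000}$; value $-\frac{1925}{71994}\sqrt2+\frac{4851099}{11999000}$; right limit $\frac{4851099}{11999000}$; slope $c_1$. - $i=4$: $x_4=\frac{1925}{298129}\sqrt2+\frac{849}{5000}$; value and right limit $\frac{67375}{3875677}\sqrt2+\frac{4851099}{11999000}$; slope $c_3$. - $i=5$: $x_5=\frac{77}{7752}\sqrt2+\frac{849}{5000}$; value $\frac{2695}{100776}\sqrt2+\frac{4851099}{11999000}$; right limit $\frac{385}{93016248}\sqrt2+\frac{4851099}{11999000}$; slope $c_1$. - $i=6$: $x_6=\frac{19}{100}$; value $\frac{18196}{59995}$; right limit $-\frac{1925}{71994}\sqrt2+\frac{275183}{599950}$; slope $c_1$. - $i=7$: $x_7=\frac{77}{22152}\sqrt2+\frac{281986521}{1490645000}$; value and right limit $-\frac{385}{22152}\sqrt2+\frac{10467633}{22933000}$; slope $c_3$. - $i=8$: $x_8=\frac{40294}{201875}$; value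 $\frac{795836841}{1937838500}$; right limit $\frac{848837}{2099500}$; slope $c_1$. - $i=9$: $x_9=\frac{36999}{184600}$; value and right limit $\frac{975607}{2399800}$; slope $c_3$. - $i=10$: $x_{10}=\frac{77}{7752}\sqrt2+\frac{19}{100}$; value $\frac{385}{93016248}\sqrt2+\frac{18196}{59995}$; right limit $-\frac{385}{7752}\sqrt2+\frac{275183}{599950}$; slope $c_3$. - $i=11$: $x_{11}=\frac{1051}{5000}$; value $-\frac{1925}{71994}\sqrt2+\frac{4291761}{11999000}$; right limit $\frac{4291761}{11999000}$; slope $c_1$. - $i=12$: $x_{12}=\frac{1925}{298129}\sqrt2+\frac{1051}{5000}$; value and right limit $\frac{67375}{3875677}\sqrt2+\frac{4291761}{11999000}$; slope $c_3$. - $i=13$: $x_{13}=\frac{14199}{64600}$; value $\frac{50943}{167960}$; right limit $\frac{192500}{3875677}\sqrt2+\frac{240046061}{775135400}$; slope $c_3$. - $i=14$: $x_{14}=\frac{77}{7752}\sqrt2+\frac{1051}{5000}$; value $\frac{2695}{100776}\sqrt2+\frac{4291761}{11999000}$; right limit $\frac{385}{93016248}\sqrt2+\frac{4291761}{11999000}$; slope $c_1$. - $i=15$: $x_{15}=\frac{77}{22152}\sqrt2+\frac{342208579}{1490645000}$; value and right limit $-\frac{385}{22152}\sqrt2+\frac{122181831}{298129000}$; slope $c_3$. - $i=16$: $x_{16}=\frac{193799}{807500}$; value and right limit $\frac{187742}{524875}$; slope $c_1$. - $i=17$: $x_{17}=\frac{219}{800}$; value $\frac{933}{2080}$; right limit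 $\frac{51443}{147680}$; slope $c_2$. - $i=18$: $x_{18}=\frac{269}{800}$; value and right limit $\frac{683}{2080}$; slope $c_1$. This defines $\pi$ on $[0,\frac{371}{800})$, which contains $[0,\frac f2]=[0,\frac25]$. For $x\in[\frac f2,f]$, set $\pi(x)=1-\pi(f-x)$ (on the overlap $[\frac f2,\frac{371}{800})$ this agrees with the formula $\pi(x)=\frac{683}{2080}+c_1(x-\frac{269}{800})$ given by the entry $i=18$; in particular $\pi(f)=1$). On $(f,1)$ set: $\pi(x)=\frac{549}{650}+c_1(x-\frac45)$ for $\frac45<x<\frac{4101}{5000}$; $\pi(\frac{4101}{5000})=\frac{9667}{13000}$; $\pi(x)=\frac{899}{1000}+c_3(x-\frac{4101}{5000})$ for $\frac{4101}{5000}<x<\frac{4899}{5000}$; $\pi(\frac{4899}{5000})=\frac{3333}{13000}$; $\pi(x)=\frac{101}{1000}+c_1(x-\frac{4899}{5000})$ for $\frac{4899}{5000}<x<1$. Extend $\pi$ to $\mathbb{R}$ periodically modulo $1$. *)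

(* Defs.v *)
From Stdlib Require Import Reals List ZArith.
From Coquelicot Require Import Coquelicot.
Import ListNotations.
Open Scope R_scope.

Definition f : R := 4 / 5.

(* [supp] lists each point of the support exactly once; it is determined by
   [mult] up to permutation, so [fsum] below depends only on [mult]. *)
Record finsupp : Type := FinSupp {
  mult :> R -> nat;
  supp : list R;
  supp_nodup : NoDup supp;
  supp_spec : forall r : R, In r supp <-> mult r <> 0%nat
}.

Definition fsum (g : R -> R) (y : finsupp) : R :=
  fold_right Rplus 0 (map (fun r => g r * INR (y r)) (supp y)).

Definition feasible (y : finsupp) : Prop :=
  exists k : Z, fsum (fun r => r) y - f = IZR k.

Definition valid (g : R -> R) : Prop :=
  (forall x : R, 0 <= g x) /\
  (forall y : finsupp, feasible y -> 1 <= fsum g y).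

(* Membership in P(g). *)
Definition tight (g : R -> R) (y : finsupp) : Prop :=
  feasible y /\ fsum g y = 1.

Definition extreme (g : R -> R) : Prop :=
  valid g /\
  forall g1 g2 : R -> R, valid g1 -> valid g2 ->
    (forall x : R, g x = 1 / 2 * (g1 x + g2 x)) ->
    (forall x : R, g x = g1 x) /\ (forall x : R, g1 x = g2 x).

Definition facet (g : R -> R) : Prop :=
  valid g /\
  forall g' : R -> R, valid g' ->
    (forall y : finsupp, tight g y -> tight g' y) ->
    forall x : R, g' x = g x.

Definition weak_facet (g : R -> R) : Prop :=
  valid g /\
  forall g' : R -> R, valid g' ->
    (forall y : finsupp, tight g y -> tight g' y) ->
    forall y : finsupp, tight g y <-> tight g' y.

(* A pair [(a, b)] of extended reals with [a < b] stands for the closed proper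
   interval of all real [x] with [a <= x <= b], bounded or not. *)
Definition in_itv (I : Rbar * Rbar) (x : R) : Prop :=
  Rbar_le (fst I) x /\ Rbar_le x (snd I).

Definition in_interior (I : Rbar * Rbar) (x : R) : Prop :=
  Rbar_lt (fst I) x /\ Rbar_lt x (snd I).

Definition is_endpoint (I : Rbar * Rbar) (x : R) : Prop :=
  fst I = Finite x \/ snd I = Finite x.

Definition locally_finite (C : Rbar * Rbar -> Prop) : Prop :=
  forall x : R, exists eps : posreal, exists l : list (Rbar * Rbar),
    forall I, C I -> (exists z : R, in_itv I z /\ Rabs (z - x) < eps) -> In I l.

Definition affine_on (D : R -> Prop) (g : R -> R) : Prop :=
  exists m c : R, forall x : R, D x -> g x = m * x + c.

Record linear_pieces (g : R -> R) (C : Rbar * Rbar -> Prop) : Prop := {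
  pieces_proper : forall I, C I -> Rbar_lt (fst I) (snd I);
  pieces_locally_finite : locally_finite C;
  pieces_cover : forall x : R, exists I, C I /\ in_itv I x;
  pieces_disjoint : forall I J, C I -> C J -> I <> J ->
    forall x : R, in_itv I x -> in_itv J x -> is_endpoint I x /\ is_endpoint J x;
  pieces_affine : forall I, C I -> affine_on (in_interior I) g
}.

Definition piecewise_linear (g : R -> R) : Prop :=
  exists C : Rbar * Rbar -> Prop, linear_pieces g C.

(* The collection of intervals is not unique, as intervals can be subdivided;
   a breakpoint of [g] itself is one that no choice of intervals can avoid. *)
Definition breakpoint (g : R -> R) (x : R) : Prop :=
  forall C : Rbar * Rbar -> Prop, linear_pieces g C ->
    exists I, C I /\ is_endpoint I x.

Definition irrational (x : R) : Prop :=
  ~ exists p q : Z, q <> 0%Z /\ x = IZR p / IZR q.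

Definition two_sided_discontinuous (g : R -> R) : Prop :=
  ~ filterlim g (at_left 0) (locally (g 0)) /\
  ~ filterlim g (at_right 0) (locally (g 0)).

(* [Piece x v r s]: value [v] at the breakpoint [x], right limit [r] at [x],
   and slope [s] from [x] to the next breakpoint. *)
Record piece : Type := Piece { bkpt : R; value : R; rlim : R; slope : R }.

Definition eval_piece (p : piece) (x : R) : R :=
  if Req_dec_T x (bkpt p) then value p else rlim p + slope p * (x - bkpt p).

(* Selects the last piece that starts at or before [x] (for a list sorted by
   [bkpt] whose first breakpoint is at most [x]). *)
Fixpoint eval_pieces (l : list piece) (x : R) : R :=
  match l with
  | [] => 0
  | p :: l' =>
      match l' with
      | [] => eval_piece p x
      | p' :: _ =>
          if Rlt_dec x (bkpt p') then eval_piece p x else eval_pieces l' x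
      end
  end.

Definition c1 : R := 35 / 13.
Definition c2 : R := 5 / 11999.
Definition c3 : R := -5.

Definition pieces_left : list piece := [
  Piece 0
        0
        (101 / 650)
        c3;
  Piece (101 / 5000)
        (2727 / 13000)
        (707 / 13000)
        c1;
  Piece (60153 / 369200)
        (421071 / 959920)
        (421071 / 959920)
        c3;
  Piece (849 / 5000)
        (- (1925 / 71994) * sqrt 2 + 4851099 / 11999000)
        (4851099 / 11999000)
        c1;
  Piece (1925 / 298129 * sqrt 2 + 849 / 5000)
        (67375 / 3875677 * sqrt 2 + 4851099 / 11999000)
        (67375 / 3875677 * sqrt 2 + 4851099 / 11999000)
        c3;
  Piece (77 / 7752 * sqrt 2 + 849 / 5000)
        (2695 / 100776 * sqrt 2 + 4851099 / 11999000)
        (385 / 93016248 * sqrt 2 + 4851099 / 11999000)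
        c1;
  Piece (19 / 100)
        (18196 / 59995)
        (- (1925 / 71994) * sqrt 2 + 275183 / 599950)
        c1;
  Piece (77 / 22152 * sqrt 2 + 281986521 / 1490645000)
        (- (385 / 22152) * sqrt 2 + 10467633 / 22933000)
        (- (385 / 22152) * sqrt 2 + 10467633 / 22933000)
        c3;
  Piece (40294 / 201875)
        (795836841 / 1937838500)
        (848837 / 2099500)
        c1;
  Piece (36999 / 184600)
        (975607 / 2399800)
        (975607 / 2399800)
        c3;
  Piece (77 / 7752 * sqrt 2 + 19 / 100)
        (385 / 93016248 * sqrt 2 + 18196 / 59995)
        (- (385 / 7752) * sqrt 2 + 275183 / 599950)
        c3;
  Piece (1051 / 5000)
        (- (1925 / 71994) * sqrt 2 + 4291761 / 11999000)
        (4291761 / 11999000)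
        c1;
  Piece (1925 / 298129 * sqrt 2 + 1051 / 5000)
        (67375 / 3875677 * sqrt 2 + 4291761 / 11999000)
        (67375 / 3875677 * sqrt 2 + 4291761 / 11999000)
        c3;
  Piece (14199 / 64600)
        (50943 / 167960)
        (192500 / 3875677 * sqrt 2 + 240046061 / 775135400)
        c3;
  Piece (77 / 7752 * sqrt 2 + 1051 / 5000)
        (2695 / 100776 * sqrt 2 + 4291761 / 11999000)
        (385 / 93016248 * sqrt 2 + 4291761 / 11999000)
        c1;
  Piece (77 / 22152 * sqrt 2 + 342208579 / 1490645000)
        (- (385 / 22152) * sqrt 2 + 122181831 / 298129000)
        (- (385 / 22152) * sqrt 2 + 122181831 / 298129000)
        c3;
  Piece (193799 / 807500)
        (187742 / 524875)
        (187742 / 524875)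
        c1;
  Piece (219 / 800)
        (933 / 2080)
        (51443 / 147680)
        c2;
  Piece (269 / 800)
        (683 / 2080)
        (683 / 2080)
        c1
].

Definition pieces_right : list piece := [
  Piece (4 / 5)
        1
        (549 / 650)
        c1;
  Piece (4101 / 5000)
        (9667 / 13000)
        (899 / 1000)
        c3;
  Piece (4899 / 5000)
        (3333 / 13000)
        (101 / 1000)
        c1
].

(* Values outside [0, 1) are irrelevant.  The last piece of [pieces_left]
   extends past f/2, and there agrees with the reflection for x < 371/800, so
   switching to the reflection already at f/2 changes nothing. *)
Definition pi_fundamental (x : R) : R :=
  if Rle_dec x (f / 2) then eval_pieces pieces_left x
  else if Rle_dec x f then 1 - eval_pieces pieces_left (f - x)
  else eval_pieces pieces_right x.

Definition pi_fun (x : R) : R := pi_fundamental (frac_part x).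

(* Main.v *)
From Stdlib Require Import Reals List ZArith QArith Lra Lia Bool ClassicalEpsilon.
From Coquelicot Require Import Coquelicot.
Require Import Defs.
Import ListNotations.
Open Scope R_scope.

(** A nonnegative function [g] with [g 0 = 0], with [g x + g z = 1] whenever
    [x + z] is [f] modulo 1, and with [1 <= g x + g y + g z] whenever
    [x + y + z] is [f] modulo 1, is periodic and subadditive, hence valid
    ([minimal_valid]).  Every valid function that is tight wherever such a [g]
    is tight has the same properties ([dominated_minimal]).  So only pairs and
    triples of points matter.

    Cut [0, 1) into faces, the breakpoints and the open intervals between them,
    on each of which [pi_fun] is affine.  For three faces, to minimize
    [pi_fun x + pi_fun y + pi_fun z] subject to [x + y + z = t] is a linear
    program in one free direction.  By duality its value is the largest, over
    the slopes [lam] in [c1], [c2], [c3], of [lam * t] plus the three infima of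
    [pi_fun - lam * id] over the faces.  All data lie in the ring generated by
    the rationals and the square root of 2, so a finite computation
    ([faces_checked]) bounds every triple sum from below.  The sum is always at
    least 1.  If [n > 0] of the three points lie in the interval
    [L = (219/800, 269/800)] or in its mirror image under [x -> f - x], then
    the sum even exceeds [1 + n * 19/23998], except for the linked triples:
    those that contain 0, and those of an anchor [a] with two points of [L].
    The three anchors are 19/100, 19/100 + 77/7752 sqrt 2 and
    19/100 + 77/2584.

    So any [p] that is periodic, odd under [x -> f - x], bounded by 19/23998,
    lives on [L] and its mirror image and cancels in linked triples can be added
    to [pi_fun] and leaves it valid ([pi_fun_perturbed]).  On [L] the condition
    at an anchor [a] says that [p] is odd under the reflection [x -> f - a - x].
    Two such reflections compose to a translation, and the translations by
    77/7752 sqrt 2 and 77/2584 obtained in this way generate a dense group.  No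
    nonzero function continuous on [L] qualifies, but a function that is
    constant on one coset of the group, opposite on the reflected coset and zero
    elsewhere does ([coset_pert_perturbation]).  Adding it and subtracting it
    shows that [pi_fun] is not extreme, and facets are extreme
    ([facet_extreme]).

    For the weak facet property let [g] be valid and tight wherever [pi_fun]
    is, and let [d = g - pi_fun].  Then [d] is bounded and sums to zero over
    every triple on which [pi_fun] is tight.  Bounded additive functions on an
    interval are linear ([window_additive_linear]), so [d] is linear on two
    intervals.  A cycle of tight triples through the anchors forces the slope
    to vanish ([diff_slope_zero]), and zeros spread along tight triples to
    every face outside [L] and its mirror image ([diff_off]).  On [L], [d] is
    invariant under the dense group of translations ([diff_lattice]).  As [g]
    still has triple sums at least 1, [d] is at least minus the infimum of the
    slack of [pi_fun] over nearby triples, which is 19/23998.  By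
    oddness [|d| <= 19/23998] ([diff_L_bound]).  Hence [d] is itself a
    perturbation of the kind above.  Where [n > 0] and the triple is not linked,
    the slack of [pi_fun] is more than [n * 19/23998], too much for [d] to
    cancel.  So [g] is tight on no further triples, and then on no further
    multisets ([tight_transfer]). *)

(** * Numbers in the ring of a + b sqrt 2, and the faces of the function *)

Definition num : Type := (Z * Z)%type.
Definition val (n : num) : R := IZR (fst n) + IZR (snd n) * sqrt 2.
Definition nadd (m n : num) : num := (fst m + fst n, snd m + snd n)%Z.
Definition nsub (m n : num) : num := (fst m - fst n, snd m - snd n)%Z.
Definition nscale (k : Z) (n : num) : num := (k * fst n, k * snd n)%Z.
Definition nint (k : Z) : num := (k, 0%Z).

Lemma val_add m n : val (nadd m n) = val m + val n.
Proof. unfold val, nadd; simpl; rewrite !plus_IZR; ring. Qed.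

Lemma val_sub m n : val (nsub m n) = val m - val n.
Proof. unfold val, nsub; simpl; rewrite !minus_IZR; ring. Qed.

Lemma val_scale k n : val (nscale k n) = IZR k * val n.
Proof. unfold val, nscale; simpl; rewrite !mult_IZR; ring. Qed.

Lemma val_int k : val (nint k) = IZR k.
Proof. unfold val, nint; simpl; ring. Qed.

Definition num_eqb (m n : num) : bool :=
  ((fst m =? fst n) && (snd m =? snd n))%Z.

Lemma num_eqb_eq m n : num_eqb m n = true -> m = n.
Proof.
  destruct m, n; unfold num_eqb; simpl.
  rewrite andb_true_iff, !Z.eqb_eq; intros [-> ->]; reflexivity.
Qed.

Definition root_den : Z := 10000000000.
Definition root_num : Z := 14142135623.

Lemma sqrt2_bounds : 1.4142135623 < sqrt 2 < 1.4142135624.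
Proof.
  rewrite <- (sqrt_square 1.4142135623), <- (sqrt_square 1.4142135624) by lra.
  split; apply sqrt_lt_1; lra.
Qed.

(** A rational test for the sign: the irrational part is rounded in the
    direction that makes the result smaller. Numbers without irrational part
    stay exact, which is what equalities in the table rely on. *)
Definition scaled (n : num) : Z :=
  match snd n with
  | Z0 => fst n
  | Zpos b => (fst n * root_den + Zpos b * root_num)%Z
  | Zneg b => (fst n * root_den + Zneg b * (root_num + 1))%Z
  end.

Definition nonneg (n : num) : bool := (0 <=? scaled n)%Z.
Definition pos (n : num) : bool := (0 <? scaled n)%Z.

Lemma scaled_bound n : exists c, 0 < c /\ IZR (scaled n) <= c * val n.
Proof.
  destruct n as [a b]; unfold scaled, val.
  assert (H := sqrt2_bounds).
  destruct b as [|b|b]; cbn [fst snd].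
  - exists 1; lra.
  - exists (IZR root_den); rewrite plus_IZR, !mult_IZR.
    assert (0 < IZR (Zpos b)) by (apply IZR_lt; lia).
    assert (0 <= IZR (Zpos b) * (sqrt 2 - 1.4142135623)) by (apply Rmult_le_pos; lra).
    unfold root_den, root_num; split; lra.
  - exists (IZR root_den); rewrite plus_IZR, !mult_IZR, plus_IZR.
    assert (IZR (Zneg b) < 0) by (apply IZR_lt; lia).
    assert (0 <= - IZR (Zneg b) * (1.4142135624 - sqrt 2)) by (apply Rmult_le_pos; lra).
    unfold root_den, root_num; split; lra.
Qed.

Lemma nonneg_sound n : nonneg n = true -> 0 <= val n.
Proof.
  unfold nonneg; rewrite Z.leb_le; intros H; apply IZR_le in H.
  destruct (scaled_bound n) as (c & ? & ?); nra.
Qed.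

Lemma pos_sound n : pos n = true -> 0 < val n.
Proof.
  unfold pos; rewrite Z.ltb_lt; intros H; apply IZR_lt in H.
  destruct (scaled_bound n) as (c & ? & ?); nra.
Qed.

(** Positions and values are integers over this common denominator, the least
    one for the breakpoints and values of the function. *)
Definition xden : Z := 232540620000.

(** The common denominator [13 * 11999] of the slopes. *)
Definition sden : Z := 155987.

(** A breakpoint, as the closed interval with [lo = hi], or an open interval
    between neighbouring breakpoints. The ends are in units of [1 / xden], the
    slope in units of [1 / sden], and the constant term of the affine function
    in units of the product. *)
Record face : Type := Face {
  lo : num; hi : num; is_open : bool; fslope : Z; fconst : num }.

Definition in_face (F : face) (x : R) : Prop :=
  if is_open F then val (lo F) < IZR xden * x < val (hi F)
  else val (lo F) <= IZR xden * x <= val (hi F).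

Definition fval (F : face) (x : R) : R :=
  (val (fconst F) + IZR (fslope F) * (IZR xden * x)) / (IZR xden * IZR sden).

(** A [piece] with its entries in units of [1 / xden] and [1 / sden]. *)
Record cell : Type := Cell { cell_x : num; cell_v : num; cell_r : num; cell_s : Z }.

Definition cell_piece (c : cell) : piece :=
  Piece (val (cell_x c) / IZR xden) (val (cell_v c) / IZR xden) (val (cell_r c) / IZR xden)
        (IZR (cell_s c) / IZR sden).

Definition point_face (c : cell) : face :=
  Face (cell_x c) (cell_x c) false 0 (nscale sden (cell_v c)).

(** The constant term moves the reference point of the affine function from the
    breakpoint to 0. *)
Definition open_face (c : cell) (h : num) : face :=
  Face (cell_x c) h true (cell_s c) (nsub (nscale sden (cell_r c)) (nscale (cell_s c) (cell_x c))).

Fixpoint faces_of (l : list cell) (e : num) : list face :=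
  match l with
  | [] => []
  | c :: l' =>
      point_face c
      :: open_face c (match l' with [] => e | c' :: _ => cell_x c' end)
      :: faces_of l' e
  end.

Lemma eval_piece_face c h x :
  val (cell_x c) <= IZR xden * x < val h ->
  exists F, (F = point_face c \/ F = open_face c h) /\
    in_face F x /\ eval_piece (cell_piece c) x = fval F x.
Proof.
  intros H; unfold eval_piece; simpl.
  assert (HD : 0 < IZR xden) by (unfold xden; lra).
  assert (HE : 0 < IZR sden) by (unfold sden; lra).
  destruct (Req_dec_T x (val (cell_x c) / IZR xden)) as [Hx|Hx].
  - exists (point_face c); split; [now left|]; unfold in_face, fval; simpl.
    rewrite val_scale.
    replace (IZR xden * x) with (val (cell_x c)) by (subst x; field; lra).
    split; [lra | field; lra].
  - exists (open_face c h); split; [now right|]; unfold in_face, fval; simpl.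
    rewrite val_sub, !val_scale; split; [split; [|lra]|field; lra].
    destruct (Rle_lt_or_eq_dec _ _ (proj1 H)) as [|Heq]; [assumption|].
    exfalso; apply Hx; rewrite Heq; field; lra.
Qed.

(** [eval_pieces] stops at the first interval whose right end exceeds [x], and
    by then [x] has passed the left end. *)
Lemma eval_pieces_face l e x :
  l <> [] ->
  (forall c, hd_error l = Some c -> val (cell_x c) <= IZR xden * x) ->
  IZR xden * x < val e ->
  exists F, In F (faces_of l e) /\
    in_face F x /\ eval_pieces (map cell_piece l) x = fval F x.
Proof.
  assert (HD : 0 < IZR xden) by (unfold xden; lra).
  induction l as [|c l' IH]; [congruence|]; intros _ Hhd He.
  specialize (Hhd c eq_refl).
  destruct l' as [|c' l''].
  - destruct (eval_piece_face c e x (conj Hhd He)) as (F & [->| ->] & HF);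
      eexists; (split; [|exact HF]); simpl; auto.
  - change (eval_pieces (map cell_piece (c :: c' :: l'')) x)
      with (if Rlt_dec x (bkpt (cell_piece c')) then eval_piece (cell_piece c) x
            else eval_pieces (map cell_piece (c' :: l'')) x).
    destruct (Rlt_dec x (bkpt (cell_piece c'))) as [Hlt|Hge]; simpl in *.
    + assert (Hlt' : IZR xden * x < val (cell_x c')).
      { apply (Rmult_lt_compat_l (IZR xden)) in Hlt; [|assumption].
        replace (IZR xden * (val (cell_x c') / IZR xden)) with (val (cell_x c')) in Hlt
          by (field; lra).
        exact Hlt. }
      destruct (eval_piece_face c (cell_x c') x (conj Hhd Hlt'))
        as (F & [->| ->] & HF); eexists; (split; [|exact HF]); auto.
    + destruct IH as (F & HIn & HF); [congruence| |assumption|].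
      * intros c0 [= <-]. apply Rnot_lt_le in Hge.
        apply (Rmult_le_compat_l (IZR xden)) in Hge; [|lra].
        replace (IZR xden * (val (cell_x c') / IZR xden)) with (val (cell_x c')) in Hge
          by (field; lra).
        exact Hge.
      * exists F; split; [|exact HF]; auto.
Qed.

Definition to_units (q : Q) : Z := (Qnum q * (xden / Zpos (Qden q)))%Z.
Definition rat (a : Q) : num := (to_units a, 0%Z).

(** The argument order of [pieces_left]: irrational part first. *)
Definition irr (b a : Q) : num := (to_units a, to_units b).
Definition c1_int : Z := 419965.
Definition c2_int : Z := 65.
Definition c3_int : Z := -779935.

Definition left_cells : list cell := [
  Cell (rat (0#1)) (rat (0#1)) (rat (101#650)) c3_int;
  Cell (rat (101#5000)) (rat (2727#13000)) (rat (707#13000)) c1_int;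
  Cell (rat (60153#369200)) (rat (421071#959920)) (rat (421071#959920)) c3_int;
  Cell (rat (849#5000)) (irr (-1925#71994) (4851099#11999000)) (rat (4851099#11999000)) c1_int;
  Cell (irr (1925#298129) (849#5000))
       (irr (67375#3875677) (4851099#11999000))
       (irr (67375#3875677) (4851099#11999000)) c3_int;
  Cell (irr (77#7752) (849#5000))
       (irr (2695#100776) (4851099#11999000))
       (irr (385#93016248) (4851099#11999000)) c1_int;
  Cell (rat (19#100)) (rat (18196#59995)) (irr (-1925#71994) (275183#599950)) c1_int;
  Cell (irr (77#22152) (281986521#1490645000))
       (irr (-385#22152) (10467633#22933000))
       (irr (-385#22152) (10467633#22933000)) c3_int;
  Cell (rat (40294#201875)) (rat (795836841#1937838500)) (rat (848837#2099500)) c1_int;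
  Cell (rat (36999#184600)) (rat (975607#2399800)) (rat (975607#2399800)) c3_int;
  Cell (irr (77#7752) (19#100))
       (irr (385#93016248) (18196#59995))
       (irr (-385#7752) (275183#599950)) c3_int;
  Cell (rat (1051#5000))
       (irr (-1925#71994) (4291761#11999000))
       (rat (4291761#11999000)) c1_int;
  Cell (irr (1925#298129) (1051#5000))
       (irr (67375#3875677) (4291761#11999000))
       (irr (67375#3875677) (4291761#11999000)) c3_int;
  Cell (rat (14199#64600))
       (rat (50943#167960))
       (irr (192500#3875677) (240046061#775135400)) c3_int;
  Cell (irr (77#7752) (1051#5000))
       (irr (2695#100776) (4291761#11999000))
       (irr (385#93016248) (4291761#11999000)) c1_int;
  Cell (irr (77#22152) (342208579#1490645000))
       (irr (-385#22152) (122181831#298129000))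
       (irr (-385#22152) (122181831#298129000)) c3_int;
  Cell (rat (193799#807500)) (rat (187742#524875)) (rat (187742#524875)) c1_int;
  Cell (rat (219#800)) (rat (933#2080)) (rat (51443#147680)) c2_int;
  Cell (rat (269#800)) (rat (683#2080)) (rat (683#2080)) c1_int
].

Definition right_cells : list cell := [
  Cell (rat (4#5)) (rat (1#1)) (rat (549#650)) c1_int;
  Cell (rat (4101#5000)) (rat (9667#13000)) (rat (899#1000)) c3_int;
  Cell (rat (4899#5000)) (rat (3333#13000)) (rat (101#1000)) c1_int
].

(** Beyond [f / 2] the last left piece coincides with its own mirror image, so
    it is kept whole and occurs twice in [faces]. *)
Definition left_end : num := rat (371#800).

(** The graph of [1 - pi (f - x)] over the reflected face. *)
Definition mirror (F : face) : face :=
  Face (nsub (rat (4#5)) (hi F)) (nsub (rat (4#5)) (lo F)) (is_open F) (fslope F)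
       (nsub (nsub (nint (xden * sden)) (fconst F)) (nscale (fslope F) (rat (4#5)))).

Definition left_faces : list face := faces_of left_cells left_end.

(** Numbering used below: with [i < 19], face [2 i] is the i-th breakpoint of
    the left table and face [2 i + 1] the interval to its right; adding 38 gives
    the mirror image; faces 76 to 81 are those of the right table. *)
Definition faces : list face :=
  left_faces ++ map mirror left_faces ++ faces_of right_cells (rat 1).

Ltac compute_units :=
  repeat match goal with |- context [to_units ?q] =>
    let v := eval vm_compute in (to_units q) in change (to_units q) with v end.

Ltac num_lra :=
  unfold val, left_end, rat, irr; cbn [fst snd]; compute_units; unfold xden, f in *; lra.

Ltac check_cells :=
  unfold cell_piece, val, c1, c2, c3; cbn [map cell_x cell_v cell_r cell_s fst snd rat irr];
  compute_units; unfold xden, sden, c1_int, c2_int, c3_int;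
  repeat match goal with |- _ :: _ = _ :: _ =>
    apply (f_equal2 cons); [apply (f_equal4 Piece); lra|] end;
  reflexivity.

Lemma left_cells_ok : map cell_piece left_cells = pieces_left.
Proof. unfold left_cells, pieces_left; check_cells. Qed.

Lemma right_cells_ok : map cell_piece right_cells = pieces_right.
Proof. unfold right_cells, pieces_right; check_cells. Qed.

Lemma val_rat_f : val (rat (4#5)) = IZR xden * f.
Proof. num_lra. Qed.

Lemma mirror_in F x : in_face F x -> in_face (mirror F) (f - x).
Proof.
  unfold in_face, mirror; destruct F as [l h [|] s c]; simpl;
  rewrite ?val_sub, val_rat_f; intros [? ?]; split; lra.
Qed.

Lemma mirror_val F x : fval (mirror F) (f - x) = 1 - fval F x.
Proof.
  unfold fval, mirror; destruct F as [l h o s c]; cbn [fconst fslope].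
  rewrite !val_sub, val_scale, val_rat_f, val_int, mult_IZR.
  unfold xden, sden; field.
Qed.

Lemma faces_cover x :
  exists F, In F faces /\ in_face F (frac_part x) /\
    pi_fun x = fval F (frac_part x).
Proof.
  unfold pi_fun; destruct (base_fp x) as [H0 H1].
  set (t := frac_part x) in *; clearbody t; clear x.
  assert (left_cover : forall t, 0 <= t <= f / 2 ->
    exists F, In F left_faces /\ in_face F t /\ eval_pieces pieces_left t = fval F t).
  { intros u Hu. rewrite <- left_cells_ok; apply eval_pieces_face.
    - discriminate.
    - intros c [= <-]. cbn [cell_x]; num_lra.
    - num_lra. }
  unfold pi_fundamental.
  destruct (Rle_dec t (f / 2)) as [Hl|Hl].
  { destruct (left_cover t) as (F & HF & ?); [lra|].
    exists F; split; [apply in_or_app|]; auto. }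
  destruct (Rle_dec t f) as [Hm|Hm].
  { destruct (left_cover (f - t)) as (F & HF & Hin & Hv); [lra|].
    exists (mirror F); repeat split.
    - apply in_or_app; right; apply in_or_app; left; now apply in_map.
    - replace t with (f - (f - t)) by ring; now apply mirror_in.
    - rewrite Hv, <- mirror_val; f_equal; ring. }
  destruct (eval_pieces_face right_cells (rat 1) t) as (F & HF & ?).
  - discriminate.
  - intros c [= <-]. cbn [cell_x]; num_lra.
  - num_lra.
  - exists F; rewrite <- right_cells_ok; split; [|assumption].
    apply in_or_app; right; apply in_or_app; now right.
Qed.

(** * The function on its faces *)

Lemma frac_part_unique x k t : 0 <= t < 1 -> x = IZR k + t -> frac_part x = t.
Proof.
  intros Ht Hx; destruct (base_fp x) as [H0 H1].
  unfold frac_part in *; set (m := Int_part x) in *.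
  enough (Hm : m = k) by (rewrite Hm in *; lra).
  assert (U : IZR m < IZR (k + 1)) by (rewrite plus_IZR; lra).
  assert (V : IZR k < IZR (m + 1)) by (rewrite plus_IZR; lra).
  apply lt_IZR in U; apply lt_IZR in V; lia.
Qed.

Lemma frac_part_id x : 0 <= x < 1 -> frac_part x = x.
Proof. intros H; apply frac_part_unique with 0%Z; [assumption|simpl; lra]. Qed.

Lemma frac_part_shift x k : frac_part (x + IZR k) = frac_part x.
Proof.
  destruct (base_fp x) as [H0 H1].
  apply frac_part_unique with (Int_part x + k)%Z; [lra|].
  rewrite plus_IZR; unfold frac_part; lra.
Qed.

Lemma pi_fun_shift x k : pi_fun (x + IZR k) = pi_fun x.
Proof. unfold pi_fun; now rewrite frac_part_shift. Qed.

Definition before (F G : face) : bool :=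
  if is_open F || is_open G then nonneg (nsub (lo G) (hi F))
  else pos (nsub (lo G) (hi F)).

Lemma before_sound F G x y :
  before F G = true -> in_face F x -> in_face G y -> x < y.
Proof.
  intros H HF HG; enough (IZR xden * x < IZR xden * y) by (unfold xden in *; lra).
  unfold before, in_face in *.
  destruct (is_open F), (is_open G); cbn [orb] in H;
    (apply nonneg_sound in H || apply pos_sound in H);
    rewrite val_sub in H; lra.
Qed.

Definition face_eqb (F G : face) : bool :=
  num_eqb (lo F) (lo G) && num_eqb (hi F) (hi G)
  && Bool.eqb (is_open F) (is_open G) && (fslope F =? fslope G)%Z && num_eqb (fconst F) (fconst G).

Lemma face_eqb_eq F G : face_eqb F G = true -> F = G.
Proof.
  destruct F, G; unfold face_eqb; cbn.
  rewrite !andb_true_iff, Z.eqb_eq; intros ((((Hl & Hh) & Ho) & Hs) & Hi).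
  apply num_eqb_eq in Hl, Hh, Hi; apply eqb_prop in Ho; congruence.
Qed.

Lemma faces_disjoint_check :
  forallb (fun F => forallb (fun G =>
    face_eqb F G || before F G || before G F) faces) faces = true.
Proof. vm_compute; reflexivity. Qed.

Lemma faces_disjoint F G x :
  In F faces -> In G faces -> in_face F x -> in_face G x -> F = G.
Proof.
  intros HF HG Hx Hx'.
  assert (H := faces_disjoint_check).
  rewrite forallb_forall in H; specialize (H F HF).
  rewrite forallb_forall in H; specialize (H G HG).
  rewrite !orb_true_iff in H; destruct H as [[H|H]|H].
  - now apply face_eqb_eq.
  - exfalso; pose proof (before_sound _ _ _ _ H Hx Hx'); lra.
  - exfalso; pose proof (before_sound _ _ _ _ H Hx' Hx); lra.
Qed.

Lemma faces_range_check :
  forallb (fun F => nonneg (lo F) &&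
    (if is_open F then nonneg (nsub (rat 1) (hi F))
     else pos (nsub (rat 1) (hi F)))) faces = true.
Proof. vm_compute; reflexivity. Qed.

Lemma faces_range F x : In F faces -> in_face F x -> 0 <= x < 1.
Proof.
  intros HF Hx.
  assert (H := faces_range_check).
  rewrite forallb_forall in H; specialize (H F HF).
  rewrite andb_true_iff in H; destruct H as [Hl Hh]; apply nonneg_sound in Hl.
  assert (Hone : val (rat 1) = IZR xden) by num_lra.
  enough (0 <= IZR xden * x < IZR xden) by (unfold xden in *; lra).
  unfold in_face in Hx; destruct (is_open F);
    (apply nonneg_sound in Hh || apply pos_sound in Hh); rewrite val_sub in Hh; lra.
Qed.

(** The face found by [faces_cover] is the given one, because distinct faces are
    disjoint. *)
Lemma pi_fun_face F x : In F faces -> in_face F x -> pi_fun x = fval F x.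
Proof.
  intros HF Hx; destruct (faces_cover x) as (G & HG & Hin & ->).
  rewrite (frac_part_id x (faces_range F x HF Hx)) in *.
  now rewrite (faces_disjoint F G x).
Qed.

(** * Lower bounds for sums over three faces *)

(** The two open intervals on which the function is not determined by its tight
    triples are those of slope [c2]. *)
Definition special (F : face) : bool := (fslope F =? c2_int)%Z.

(** The infimum of the slack [pi x + pi y + pi z - 1] over the triples with
    exactly one point in a special interval. It is approached, but not attained,
    as [x] tends to 29395/100000, with [y = 421/800]. *)
Definition slack_unit : R := 19 / 23998.
Definition slack_units : Z := 247 * 116270310000.

Lemma slack_units_val : IZR slack_units = slack_unit * (IZR xden * IZR sden).
Proof. unfold slack_units, slack_unit, xden, sden; simpl (_ * _)%Z; lra. Qed.

(** The infimum of [pi - lam * id] over a face is the limit at one end, and the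
    sign of [fslope F - lam] tells which. *)
Definition inf_tilt (lam : Z) (F : face) : num :=
  nadd (fconst F) (nscale (fslope F - lam) (if (lam <=? fslope F)%Z then lo F else hi F)).

Definition attains (lam : Z) (F : face) : bool := negb (is_open F) || (fslope F =? lam)%Z.

Lemma inf_tilt_le lam F x :
  in_face F x ->
  val (inf_tilt lam F) <= val (fconst F) + (IZR (fslope F) - IZR lam) * (IZR xden * x).
Proof.
  intros Hx; unfold inf_tilt; rewrite val_add, val_scale, minus_IZR.
  assert (Hx' : val (lo F) <= IZR xden * x <= val (hi F))
    by (unfold in_face in Hx; destruct (is_open F); lra).
  apply Rplus_le_compat_l.
  destruct (Z.leb_spec lam (fslope F)) as [H|H].
  - apply IZR_le in H; apply Rmult_le_compat_l; lra.
  - apply IZR_lt in H.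
    assert (0 <= (IZR lam - IZR (fslope F)) * (val (hi F) - IZR xden * x))
      by (apply Rmult_le_pos; lra); lra.
Qed.

Lemma inf_tilt_lt lam F x :
  in_face F x -> attains lam F = false ->
  val (inf_tilt lam F) < val (fconst F) + (IZR (fslope F) - IZR lam) * (IZR xden * x).
Proof.
  intros Hx Ha; unfold inf_tilt; rewrite val_add, val_scale, minus_IZR.
  unfold attains in Ha; apply orb_false_iff in Ha; destruct Ha as [Ho Hs].
  apply negb_false_iff in Ho; unfold in_face in Hx; rewrite Ho in Hx.
  apply Z.eqb_neq in Hs.
  apply Rplus_lt_compat_l.
  destruct (Z.leb_spec lam (fslope F)) as [H|H].
  - assert (H' : (lam < fslope F)%Z) by lia.
    apply IZR_lt in H'; apply Rmult_lt_compat_l; lra.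
  - apply IZR_lt in H.
    assert (0 < (IZR lam - IZR (fslope F)) * (val (hi F) - IZR xden * x))
      by (apply Rmult_lt_0_compat; lra); lra.
Qed.

Definition special_count (F G H : face) : Z :=
  (Z.b2z (special F) + Z.b2z (special G) + Z.b2z (special H))%Z.

(** The dual bound with multiplier [lam]. When the bound is exactly met, the
    strict inequality still holds if some infimum is not attained. *)
Definition roomy_at (t : num) (F G H : face) (lam : Z) : bool :=
  let room :=
    nsub (nadd (nadd (nadd (inf_tilt lam F) (inf_tilt lam G)) (inf_tilt lam H))
               (nscale lam t))
         (nint (xden * sden + special_count F G H * slack_units)) in
  if pos room then true else if nonneg room then
    (special_count F G H =? 0)%Z || negb (attains lam F && attains lam G && attains lam H)
  else false.

Definition roomy (F G H : face) (x y z : R) : Prop :=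
  1 + IZR (special_count F G H) * slack_unit <= fval F x + fval G y + fval H z /\
  (special_count F G H <> 0%Z ->
   1 + IZR (special_count F G H) * slack_unit < fval F x + fval G y + fval H z).

Lemma roomy_at_sound t F G H lam x y z :
  roomy_at t F G H lam = true ->
  in_face F x -> in_face G y -> in_face H z -> IZR xden * (x + y + z) = val t ->
  roomy F G H x y z.
Proof.
  unfold roomy_at.
  set (room := nsub _ _); intros Hroom HF HG HH Ht.
  assert (Hn : 0 <= val room /\ (0 < val room \/
    (special_count F G H =? 0)%Z || negb (attains lam F && attains lam G && attains lam H) = true)).
  { destruct (pos room) eqn:Hp; [apply pos_sound in Hp; lra|].
    destruct (nonneg room) eqn:Hn; [apply nonneg_sound in Hn; auto|discriminate]. }
  clear Hroom; subst room; destruct Hn as [Hn Ha].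
  rewrite val_sub, !val_add, val_scale, val_int, plus_IZR, !mult_IZR, <- Ht in Hn, Ha.
  assert (KF := inf_tilt_le lam F x HF).
  assert (KG := inf_tilt_le lam G y HG).
  assert (KH := inf_tilt_le lam H z HH).
  assert (HP : 0 < IZR xden * IZR sden) by (unfold xden, sden; lra).
  rewrite slack_units_val in Hn, Ha.
  assert (Hsum : fval F x + fval G y + fval H z =
    (val (fconst F) + IZR (fslope F) * (IZR xden * x)
     + (val (fconst G) + IZR (fslope G) * (IZR xden * y))
     + (val (fconst H) + IZR (fslope H) * (IZR xden * z))) / (IZR xden * IZR sden))
    by (unfold fval; field; unfold xden, sden; lra).
  unfold roomy; rewrite Hsum; clear Hsum.
  set (n := IZR (special_count F G H)) in *.
  split; [apply (Rmult_le_reg_r (IZR xden * IZR sden)); [assumption|]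
         |intros Hne; apply (Rmult_lt_reg_r (IZR xden * IZR sden)); [assumption|]];
  (match goal with |- context [?a / ?b * ?b] =>
     replace (a / b * b) with a by (field; unfold xden, sden; lra) end);
  [lra|].
  destruct Ha as [Ha|Ha]; [lra|].
  apply orb_true_iff in Ha; destruct Ha as [Ha|Ha]; [apply Z.eqb_eq in Ha; contradiction|].
  apply negb_true_iff in Ha; apply andb_false_iff in Ha.
  destruct Ha as [Ha|Ha]; [apply andb_false_iff in Ha; destruct Ha as [Ha|Ha]|].
  - assert (K' := inf_tilt_lt lam F x HF Ha); lra.
  - assert (K' := inf_tilt_lt lam G y HG Ha); lra.
  - assert (K' := inf_tilt_lt lam H z HH Ha); lra.
Qed.

Definition anchors : list num :=
  [rat (19#100); irr (77#7752) (19#100); rat (14199#64600)].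

Definition is_point (F : face) (n : num) : bool :=
  num_eqb (lo F) n && num_eqb (hi F) n.

Definition is_left_special (F : face) : bool :=
  is_open F && num_eqb (lo F) (rat (219#800)) && num_eqb (hi F) (rat (269#800)).

Definition linkedb (F G H : face) : bool :=
  is_point F (nint 0)
  || existsb (is_point F) anchors && is_left_special G && is_left_special H.

Definition anchor (x : R) : Prop :=
  x = 19 / 100 \/ x = 19 / 100 + 77 / 7752 * sqrt 2 \/ x = 19 / 100 + 77 / 2584.

Definition in_L (x : R) : Prop := 219 / 800 < x < 269 / 800.

(** Up to order, every triple with a special point and with sum of values 1. At
    an anchor both other points lie on the piece of slope [c2], so the sum does
    not depend on where they are. *)
Definition linked (x y z : R) : Prop :=
  x = 0 \/ anchor x /\ in_L y /\ in_L z.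

Lemma is_point_sound F n x : is_point F n = true -> in_face F x -> IZR xden * x = val n.
Proof.
  unfold is_point; rewrite andb_true_iff; intros [H1 H2] Hx.
  apply num_eqb_eq in H1, H2; unfold in_face in Hx; rewrite H1, H2 in Hx.
  destruct (is_open F); lra.
Qed.

Lemma is_left_special_sound F x : is_left_special F = true -> in_face F x -> in_L x.
Proof.
  unfold is_left_special; rewrite !andb_true_iff; intros [[H0 H1] H2] Hx.
  apply num_eqb_eq in H1, H2; unfold in_face in Hx; rewrite H0, H1, H2 in Hx.
  unfold in_L; revert Hx; unfold val, rat; cbn [fst snd]; compute_units; unfold xden; intros; lra.
Qed.

Lemma linkedb_sound F G H x y z :
  linkedb F G H = true -> in_face F x -> in_face G y -> in_face H z -> linked x y z.
Proof.
  unfold linkedb; rewrite orb_true_iff, !andb_true_iff.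
  intros [H0|[[Ha HL] HL']] HF HG HH; [left|right; split; [|split]].
  - assert (K := is_point_sound _ _ _ H0 HF); rewrite val_int in K; unfold xden in K; lra.
  - apply existsb_exists in Ha; destruct Ha as (n & Hn & Hp).
    assert (K := is_point_sound _ _ _ Hp HF).
    destruct Hn as [<-|[<-|[<-|[]]]]; [left|right; left|right; right];
      revert K; unfold val, rat, irr; cbn [fst snd]; compute_units; unfold xden; intros; lra.
  - exact (is_left_special_sound G y HL HG).
  - exact (is_left_special_sound H z HL' HH).
Qed.

(** Rounding the ends of the faces to multiples of 1/1000 rules out most triples
    of faces with arithmetic on small integers only. *)
Definition coarse : Z := 232540620.

(** The values [f], [f + 1] and [f + 2] that a sum of three numbers in [0, 1)
    can take, in thousandths. *)
Definition targets : list Z := [800; 1800; 2800]%Z.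

Record box : Type := Box { core : face; low : Z; high : Z }.

(** The proposed bounds are only guesses; [box_ok] is what vouches for them. *)
Definition boxed (F : face) : box :=
  let fl n := ((fst n + snd n * root_num / root_den) / coarse)%Z in
  Box F (fl (lo F)) (fl (hi F) + 1)%Z.

Definition box_ok (B : box) : bool :=
  nonneg (nsub (lo (core B)) (nint (low B * coarse))) &&
  nonneg (nsub (nint (high B * coarse)) (hi (core B))).

Lemma if_true_orb (a b : bool) : (if a then true else b) = a || b.
Proof. now destruct a. Qed.

(** An open end that only touches the plane [x + y + z = t] is excluded by the
    weak inequality; for three points a strict one is required. *)
Definition apart (t : num) (F G H : face) : bool :=
  let l := nadd (nadd (lo F) (lo G)) (lo H) in
  let h := nadd (nadd (hi F) (hi G)) (hi H) in
  let away := if is_open F || is_open G || is_open H then nonneg else pos in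
  if away (nsub l t) then true else away (nsub t h).

Lemma apart_sound t F G H x y z :
  apart t F G H = true -> in_face F x -> in_face G y -> in_face H z ->
  IZR xden * (x + y + z) <> val t.
Proof.
  unfold apart; intros Hc HF HG HH Ht.
  replace (IZR xden * (x + y + z)) with (IZR xden * x + IZR xden * y + IZR xden * z) in Ht by ring.
  rewrite if_true_orb, orb_true_iff in Hc; destruct Hc as [Hc|Hc];
    unfold in_face in *; destruct (is_open F), (is_open G), (is_open H);
    cbn [orb] in Hc; (apply nonneg_sound in Hc || apply pos_sound in Hc);
    rewrite val_sub, !val_add in Hc; lra.
Qed.

(** The multiplier of an optimal dual solution may be taken among the slopes.
    Conditionals rather than disjunctions keep the evaluation lazy. *)
Definition check_at (t : num) (F G H : face) : bool :=
  if apart t F G H then true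
  else if roomy_at t F G H c1_int then true else if roomy_at t F G H c2_int then true
  else if roomy_at t F G H c3_int then true
  else linkedb F G H || linkedb G F H || linkedb H F G.

Definition check (A B C : box) : bool :=
  let l := (low A + low B + low C)%Z in
  let h := (high A + high B + high C)%Z in
  forallb (fun t =>
    if (t <? l)%Z then true else if (h <? t)%Z then true
    else check_at (nint (t * coarse)) (core A) (core B) (core C)) targets.

Definition perm3 (P : R -> R -> R -> Prop) (x y z : R) : Prop :=
  P x y z \/ P y x z \/ P z x y.

Lemma box_ok_sound B x :
  box_ok B = true -> in_face (core B) x ->
  IZR (low B) <= 1000 * x <= IZR (high B).
Proof.
  unfold box_ok; rewrite andb_true_iff; intros [Hl Hh] Hx.
  apply nonneg_sound in Hl; apply nonneg_sound in Hh.
  rewrite val_sub, val_int, mult_IZR in Hl, Hh.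
  unfold in_face, coarse, xden in *; destruct (is_open (core B)); lra.
Qed.

Definition triple_slack (F G H : face) : Prop :=
  forall x y z k, in_face F x -> in_face G y -> in_face H z ->
    0 <= x < 1 -> 0 <= y < 1 -> 0 <= z < 1 -> x + y + z = f + IZR k ->
    roomy F G H x y z \/ perm3 linked x y z.

Lemma check_at_sound t F G H x y z :
  check_at t F G H = true -> in_face F x -> in_face G y -> in_face H z ->
  IZR xden * (x + y + z) = val t -> roomy F G H x y z \/ perm3 linked x y z.
Proof.
  unfold check_at; intros Hc HF HG HH Ht.
  rewrite !if_true_orb, !orb_true_iff in Hc.
  destruct Hc as [Hc|[Hc|[Hc|[Hc|[[Hc|Hc]|Hc]]]]].
  1: exfalso; eapply apart_sound; eassumption.
  1, 2, 3: left; eapply roomy_at_sound; eassumption.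
  - right; left; eapply linkedb_sound; eassumption.
  - right; right; left; eapply linkedb_sound; eassumption.
  - right; right; right; eapply linkedb_sound; eassumption.
Qed.

Lemma check_triple_slack A B C :
  box_ok A = true -> box_ok B = true -> box_ok C = true ->
  check A B C = true -> triple_slack (core A) (core B) (core C).
Proof.
  unfold check; intros HA HB HC Hc x y z k HF HG HH Hx Hy Hz Hk.
  assert (KA := box_ok_sound _ _ HA HF).
  assert (KB := box_ok_sound _ _ HB HG).
  assert (KC := box_ok_sound _ _ HC HH).
  assert (Ht : exists t, In t targets /\ 1000 * (x + y + z) = IZR t).
  { assert (Hk' : (k = 0 \/ k = 1 \/ k = 2)%Z).
    { unfold f in Hk; assert (K : -1 < IZR k < 3) by lra.
      destruct K as [K1 K2]; apply lt_IZR in K1; apply lt_IZR in K2; lia. }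
    unfold f in Hk; rewrite Hk; destruct Hk' as [->|[->| ->]];
      [exists 800%Z|exists 1800%Z|exists 2800%Z]; (split; [simpl; tauto|lra]). }
  destruct Ht as (t & HIn & Ht).
  rewrite forallb_forall in Hc; specialize (Hc t HIn); clear HIn.
  destruct (Z.ltb_spec t (low A + low B + low C)) as [Hl|_].
  { exfalso; apply IZR_lt in Hl; rewrite !plus_IZR in Hl; lra. }
  destruct (Z.ltb_spec (high A + high B + high C) t) as [Hl|_].
  { exfalso; apply IZR_lt in Hl; rewrite !plus_IZR in Hl; lra. }
  eapply check_at_sound; try eassumption.
  rewrite val_int, mult_IZR, <- Ht; unfold xden, coarse; lra.
Qed.

Lemma linked_swap x y z : linked x y z -> linked x z y.
Proof. unfold linked; tauto. Qed.

Lemma triple_slack_swap F G H : triple_slack F G H -> triple_slack G F H.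
Proof.
  intros Hg x y z k ? ? ? ? ? ? Hk.
  destruct (Hg y x z k) as [Hr|Hr]; try assumption; [lra|left|right].
  - unfold roomy, special_count in *. rewrite (Z.add_comm (Z.b2z (special G))).
    destruct Hr as [Hr Hr']; split; [lra|intros Hne; specialize (Hr' Hne); lra].
  - unfold perm3 in *; destruct Hr as [?|[?|?]]; auto using linked_swap.
Qed.

Lemma triple_slack_rot F G H : triple_slack F G H -> triple_slack F H G.
Proof.
  intros Hg x y z k ? ? ? ? ? ? Hk.
  destruct (Hg x z y k) as [Hr|Hr]; try assumption; [lra|left|right].
  - unfold roomy in *.
    replace (special_count F H G) with (special_count F G H)
      by (unfold special_count; lia).
    destruct Hr as [Hr Hr']; split; [lra|intros Hne; specialize (Hr' Hne); lra].
  - unfold perm3 in *; destruct Hr as [?|[?|?]]; auto using linked_swap.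
Qed.

Fixpoint check_pairs (A : box) (l : list box) : bool :=
  match l with
  | [] => true
  | B :: l' => if forallb (check A B) l then check_pairs A l' else false
  end.

Fixpoint check_triples (l : list box) : bool :=
  match l with
  | [] => true
  | A :: l' => if check_pairs A l then check_triples l' else false
  end.

Section Soundness_of_triples.
  Variable l0 : list box.
  Hypothesis l0_ok : forall B, In B l0 -> box_ok B = true.

  Lemma check_pairs_sound A l :
    In A l0 -> incl l l0 -> check_pairs A l = true ->
    forall B C, In B l -> In C l -> triple_slack (core A) (core B) (core C).
  Proof.
    intros HA; induction l as [|K l IH]; [now intros|].
    cbn [check_pairs]; intros Hl Hc B C HB HC.
    assert (HK : forall X, In X (K :: l) -> box_ok X = true) by auto.
    destruct (forallb _ _) eqn:Hh in Hc; [|discriminate].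
    rewrite forallb_forall in Hh.
    assert (HA' := l0_ok A HA).
    destruct HB as [->|HB];
      [apply check_triple_slack; [..|now apply Hh]; auto using in_eq|].
    destruct HC as [->|HC];
      [apply triple_slack_rot; apply check_triple_slack; [..|apply Hh]; auto using in_eq, in_cons|].
    apply IH; auto; intros X ?; apply Hl; now right.
  Qed.

  (** Only triples in list order are checked; the others follow by symmetry. *)
  Lemma check_triples_sound l :
    incl l l0 -> check_triples l = true ->
    forall A B C, In A l -> In B l -> In C l -> triple_slack (core A) (core B) (core C).
  Proof.
    induction l as [|K l IH]; [now intros|].
    cbn [check_triples]; intros Hl Hc A B C HA HB HC.
    destruct (check_pairs _ _) eqn:Hp in Hc; [|discriminate].
    assert (Hp' := check_pairs_sound K _ (Hl _ (in_eq K l)) Hl Hp).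
    assert (Hl' : incl l l0) by (intros X ?; apply Hl; now right).
    destruct HA as [->|HA]; [now apply Hp'|].
    destruct HB as [->|HB]; [apply triple_slack_swap; apply Hp'; auto using in_eq, in_cons|].
    destruct HC as [->|HC];
      [apply triple_slack_rot; apply triple_slack_swap; apply Hp'; auto using in_eq, in_cons
      | now apply IH].
  Qed.
End Soundness_of_triples.

Lemma boxes_ok : forallb box_ok (map boxed faces) = true.
Proof. vm_compute; reflexivity. Qed.

Lemma faces_checked : check_triples (map boxed faces) = true.
Proof. vm_compute; reflexivity. Qed.

Lemma faces_triple_slack F G H : In F faces -> In G faces -> In H faces -> triple_slack F G H.
Proof.
  intros HF HG HH.
  apply (check_triples_sound (map boxed faces)) with (l := map boxed faces)
    (A := boxed F) (B := boxed G) (C := boxed H);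
    try (now apply in_map); [|apply incl_refl|apply faces_checked].
  apply forallb_forall, boxes_ok.
Qed.

(** * Multisets as lists, and minimal functions *)

Definition lsum (g : R -> R) (l : list R) : R := fold_right Rplus 0 (map g l).

Lemma lsum_app g l m : lsum g (l ++ m) = lsum g l + lsum g m.
Proof. unfold lsum; induction l; simpl in *; lra. Qed.

Lemma lsum_repeat g x n : lsum g (repeat x n) = g x * INR n.
Proof.
  induction n as [|n IH]; [unfold lsum; simpl; lra|].
  rewrite S_INR; unfold lsum in *; simpl; lra.
Qed.

Definition entries (y : finsupp) : list R :=
  flat_map (fun r => repeat r (y r)) (supp y).

Lemma fsum_entries g y : fsum g y = lsum g (entries y).
Proof.
  unfold fsum, entries; induction (supp y) as [|r s IH]; [reflexivity|].
  cbn [flat_map map fold_right]; rewrite lsum_app, lsum_repeat, IH; reflexivity.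
Qed.

Lemma of_list_spec l r :
  In r (nodup Req_dec_T l) <-> count_occ Req_dec_T l r <> 0%nat.
Proof. rewrite nodup_In, (count_occ_In Req_dec_T); lia. Qed.

Definition of_list (l : list R) : finsupp :=
  FinSupp (count_occ Req_dec_T l) (nodup Req_dec_T l)
    (NoDup_nodup Req_dec_T l) (of_list_spec l).

(** One more copy of [a] adds [g a] exactly once, as [s] has no repetitions. *)
Lemma sum_count_cons g a l s :
  NoDup s ->
  fold_right Rplus 0 (map (fun r => g r * INR (count_occ Req_dec_T (a :: l) r)) s)
  = fold_right Rplus 0 (map (fun r => g r * INR (count_occ Req_dec_T l r)) s)
    + if in_dec Req_dec_T a s then g a else 0.
Proof.
  induction 1 as [|b s Hb Hs IH]; [simpl; lra|].
  cbn [map fold_right]; rewrite IH; clear IH.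
  destruct (in_dec Req_dec_T a (b :: s)) as [Hin|Hin];
    destruct (in_dec Req_dec_T a s) as [Hin'|Hin'];
    destruct (Req_dec_T a b) as [Hab|Hab].
  - subst; contradiction.
  - rewrite count_occ_cons_neq by congruence; lra.
  - subst; rewrite count_occ_cons_eq, S_INR by reflexivity; lra.
  - destruct Hin; [congruence|contradiction].
  - subst; exfalso; apply Hin; now left.
  - exfalso; apply Hin; now right.
  - subst; exfalso; apply Hin; now left.
  - rewrite count_occ_cons_neq by congruence; lra.
Qed.

Lemma fsum_of_list g l : fsum g (of_list l) = lsum g l.
Proof.
  unfold fsum; cbn [of_list mult supp].
  induction l as [|a l IH]; [reflexivity|].
  unfold lsum in *; cbn [nodup]; destruct (in_dec Req_dec_T a l) as [Ha|Ha].
  - rewrite sum_count_cons by apply NoDup_nodup; rewrite IH.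
    destruct (in_dec Req_dec_T a (nodup Req_dec_T l)) as [_|N];
      [simpl; lra|now rewrite nodup_In in N].
  - cbn [map fold_right]; rewrite sum_count_cons by apply NoDup_nodup.
    destruct (in_dec Req_dec_T a (nodup Req_dec_T l)) as [Y|_];
      [now rewrite nodup_In in Y|].
    rewrite IH, count_occ_cons_eq by reflexivity.
    rewrite (count_occ_not_In Req_dec_T) in Ha; rewrite Ha; simpl; lra.
Qed.

Lemma tight_list g l k :
  lsum (fun r => r) l = f + IZR k -> lsum g l = 1 -> tight g (of_list l).
Proof.
  intros Hl Hg; split; [exists k|]; rewrite fsum_of_list; lra.
Qed.

(** The conditions that reduce validity to sums of at most three terms;
    [min_triple] is subadditivity in symmetric form. *)
Record minimal (g : R -> R) : Prop := {
  min_nonneg : forall x, 0 <= g x;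
  min_zero : g 0 = 0;
  min_sym : forall x z k, x + z = f + IZR k -> g x + g z = 1;
  min_triple : forall x y z k, x + y + z = f + IZR k -> 1 <= g x + g y + g z }.

Section Minimal.
  Variable g : R -> R.
  Hypothesis Hg : minimal g.

  (** Both [x] and [x + k] are complementary to [f - x]. *)
  Lemma min_shift x k : g (x + IZR k) = g x.
  Proof.
    assert (H1 := min_sym g Hg x (f - x) 0 ltac:(simpl; lra)).
    assert (H2 := min_sym g Hg (x + IZR k) (f - x) k ltac:(lra)); lra.
  Qed.

  Lemma min_subadditive x y : g (x + y) <= g x + g y.
  Proof.
    assert (H1 := min_triple g Hg x y (f - (x + y)) 0 ltac:(simpl; lra)).
    assert (H2 := min_sym g Hg (x + y) (f - (x + y)) 0 ltac:(simpl; lra)); lra.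
  Qed.

  Lemma min_subadditive_list l : g (lsum (fun r => r) l) <= lsum g l.
  Proof.
    unfold lsum; induction l as [|a l IH]; cbn [map fold_right].
    - rewrite (min_zero g Hg); lra.
    - eapply Rle_trans; [apply min_subadditive|]; lra.
  Qed.

  Lemma min_one k : g (f + IZR k) = 1.
  Proof.
    assert (H1 := min_sym g Hg 0 (f + IZR k) k ltac:(lra)).
    rewrite (min_zero g Hg) in H1; lra.
  Qed.

  Lemma minimal_valid : valid g.
  Proof.
    split; [apply (min_nonneg g Hg)|]; intros y [k Hk].
    rewrite fsum_entries in Hk; rewrite fsum_entries.
    eapply Rle_trans; [|apply min_subadditive_list].
    replace (lsum _ _) with (f + IZR k) by lra; rewrite min_one; lra.
  Qed.
End Minimal.

(** Subadditivity along a list is an equality if and only if each partial sum is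
    additive, and an additive pair [a, s] is the triple [a, s, f - (a + s)]. *)
Lemma tight_transfer g g' :
  minimal g -> minimal g' ->
  (forall x y z k, x + y + z = f + IZR k ->
     g' x + g' y + g' z = 1 -> g x + g y + g z = 1) ->
  forall y, tight g' y -> tight g y.
Proof.
  intros Hg Hg' Htr y [[k Hk] H1]; split; [now exists k|].
  rewrite fsum_entries in *.
  enough (Hadd : forall l, lsum g' l = g' (lsum (fun r => r) l) ->
                           lsum g l = g (lsum (fun r => r) l)).
  { assert (Hs : lsum (fun r => r) (entries y) = f + IZR k) by lra.
    rewrite Hadd; rewrite Hs; [now apply min_one|].
    rewrite H1; symmetry; now apply min_one. }
  unfold lsum; induction l as [|a l IH]; cbn [map fold_right].
  - rewrite (min_zero g Hg); reflexivity.
  - set (s := fold_right Rplus 0 (map (fun r => r) l)) in *; intros Ha.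
    assert (K1 := min_subadditive_list g' Hg' l); unfold lsum in K1; fold s in K1.
    assert (K2 := min_subadditive g' Hg' a s).
    rewrite IH by lra.
    assert (K3 := min_sym g' Hg' (a + s) (f - (a + s)) 0 ltac:(simpl; lra)).
    assert (K4 := min_sym g Hg (a + s) (f - (a + s)) 0 ltac:(simpl; lra)).
    assert (K5 := Htr a s (f - (a + s)) 0%Z ltac:(simpl; lra) ltac:(lra)); lra.
Qed.

Section Dominated.
  Variables g g' : R -> R.
  Hypothesis Hg : minimal g.
  Hypothesis Hv : valid g'.
  Hypothesis Ht : forall y, tight g y -> tight g' y.

  Lemma dominated_list l k :
    lsum (fun r => r) l = f + IZR k -> lsum g l = 1 -> lsum g' l = 1.
  Proof.
    intros Hl H1; destruct (Ht _ (tight_list g l k Hl H1)) as [_ K].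
    now rewrite fsum_of_list in K.
  Qed.

  Lemma dominated_triple x y z k :
    x + y + z = f + IZR k -> g x + g y + g z = 1 -> g' x + g' y + g' z = 1.
  Proof.
    intros Hk H1.
    assert (K := dominated_list [x; y; z] k); unfold lsum in K; simpl in K.
    specialize (K ltac:(lra) ltac:(lra)); lra.
  Qed.

  (** Each equation is a multiset on which [g] is tight: [x, f - x], and for [g'
      0 = 0] both [0, f] and [0, 0, f]. *)
  Lemma dominated_minimal : minimal g'.
  Proof.
    assert (Hsym : forall x z k, x + z = f + IZR k -> g' x + g' z = 1).
    { intros x z k Hk.
      assert (K := dominated_list [x; z] k); unfold lsum in K; simpl in K.
      assert (K1 := min_sym g Hg x z k Hk).
      specialize (K ltac:(lra) ltac:(lra)); lra. }
    split; [apply Hv| |assumption|].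
    - assert (Z0 := min_zero g Hg).
      assert (S0 := min_sym g Hg 0 f 0 ltac:(simpl; lra)).
      assert (S1 := Hsym 0 f 0%Z ltac:(simpl; lra)).
      assert (S2 := dominated_triple 0 0 f 0 ltac:(simpl; lra) ltac:(lra)); lra.
    - intros x y z k Hk; destruct Hv as [_ Hv'].
      specialize (Hv' (of_list [x; y; z])); rewrite fsum_of_list in Hv'.
      unfold lsum in Hv'; simpl in Hv'; rewrite <- !Rplus_assoc, Rplus_0_r in Hv'.
      apply Hv'; exists k; rewrite fsum_of_list; unfold lsum; simpl; lra.
  Qed.
End Dominated.

(** * Nonnegativity and symmetry *)

(** The function [pi - lam * id] is constant on the face. *)
Definition flat (lam : Z) (F : face) : bool :=
  (fslope F =? lam)%Z || num_eqb (lo F) (hi F).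

Lemma flat_sound lam F x :
  flat lam F = true -> in_face F x ->
  val (fconst F) + (IZR (fslope F) - IZR lam) * (IZR xden * x) = val (inf_tilt lam F).
Proof.
  unfold flat, inf_tilt; rewrite orb_true_iff, val_add, val_scale, minus_IZR.
  intros [H|H] Hx.
  - apply Z.eqb_eq in H; rewrite H; ring.
  - apply num_eqb_eq in H; f_equal; f_equal.
    unfold in_face in Hx; rewrite H in *.
    destruct (is_open F), (lam <=? fslope F)%Z; lra.
Qed.

(** With a multiplier equal to the slope of every open face involved, the dual
    bound is an equality on the whole face. *)
Definition tight_at (t : num) (F G H : face) : bool :=
  existsb (fun lam =>
    flat lam F && flat lam G && flat lam H &&
    num_eqb (nadd (nadd (nadd (inf_tilt lam F) (inf_tilt lam G)) (inf_tilt lam H))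
               (nscale lam t)) (nint (xden * sden))) [c1_int; c2_int; c3_int].

Lemma tight_at_sound t F G H x y z :
  tight_at t F G H = true -> in_face F x -> in_face G y -> in_face H z ->
  IZR xden * (x + y + z) = val t -> fval F x + fval G y + fval H z = 1.
Proof.
  unfold tight_at; intros Hc HF HG HH Ht.
  apply existsb_exists in Hc; destruct Hc as (lam & _ & Hc).
  rewrite !andb_true_iff in Hc; destruct Hc as [[[KF KG] KH] Hc].
  apply (flat_sound _ _ _ KF) in HF; apply (flat_sound _ _ _ KG) in HG;
    apply (flat_sound _ _ _ KH) in HH.
  apply num_eqb_eq, (f_equal val) in Hc.
  rewrite !val_add, val_scale, val_int, mult_IZR, <- Ht in Hc.
  unfold fval; apply (Rmult_eq_reg_r (IZR xden * IZR sden)); [|unfold xden, sden; lra].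
  field_simplify; [lra|unfold xden, sden; lra].
Qed.

Definition zero_face : face := Face (nint 0) (nint 0) false 0 (nint 0).

Lemma zero_face_in : in_face zero_face 0.
Proof. unfold in_face; simpl; rewrite val_int; lra. Qed.

Lemma zero_face_val : fval zero_face 0 = 0.
Proof. unfold fval; cbn [zero_face fconst fslope]; rewrite val_int; unfold xden, sden; lra. Qed.

Lemma zero_face_face : In zero_face faces.
Proof. left; reflexivity. Qed.

Lemma pi_fun_0 : pi_fun 0 = 0.
Proof.
  rewrite (pi_fun_face zero_face); [apply zero_face_val|apply zero_face_face|apply zero_face_in].
Qed.

Definition target_units : list num := map (fun t => nint (t * coarse)) targets.

Lemma target_spec x k :
  0 <= x < 3 -> x = f + IZR k -> exists t, In t target_units /\ IZR xden * x = val t.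
Proof.
  intros Hx Hk.
  assert (Hk' : (k = 0 \/ k = 1 \/ k = 2)%Z).
  { unfold f in Hk; assert (K : -1 < IZR k < 3) by lra.
    destruct K as [K1 K2]; apply lt_IZR in K1; apply lt_IZR in K2; lia. }
  unfold f in Hk; rewrite Hk; clear Hk; destruct Hk' as [->|[->| ->]];
    [exists (nint (800 * coarse))|exists (nint (1800 * coarse))
    |exists (nint (2800 * coarse))];
    (split; [simpl; tauto|rewrite val_int, mult_IZR; unfold xden, coarse; lra]).
Qed.

(** Symmetry is tightness of the triples with the point 0. *)
Lemma faces_symmetric_check :
  forallb (fun F => forallb (fun G => forallb (fun t =>
    if apart t F G zero_face then true else tight_at t F G zero_face)
    target_units) faces) faces = true.
Proof. vm_compute; reflexivity. Qed.

Lemma pi_fun_sym x z k : x + z = f + IZR k -> pi_fun x + pi_fun z = 1.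
Proof.
  intros Hk.
  destruct (faces_cover x) as (F & HF & Hx & ->).
  destruct (faces_cover z) as (G & HG & Hz & ->).
  assert (Hx1 := faces_range _ _ HF Hx); assert (Hz1 := faces_range _ _ HG Hz).
  destruct (target_spec (frac_part x + frac_part z + 0) (k - Int_part x - Int_part z))
    as (t & Ht & Hs); [lra|unfold frac_part; rewrite !minus_IZR; lra|].
  assert (H := faces_symmetric_check).
  rewrite forallb_forall in H; specialize (H F HF).
  rewrite forallb_forall in H; specialize (H G HG).
  rewrite forallb_forall in H; specialize (H t Ht); cbn beta in H.
  destruct (apart t F G zero_face) eqn:Ha.
  - exfalso; exact (apart_sound _ _ _ _ _ _ _ Ha Hx Hz zero_face_in Hs).
  - assert (K := tight_at_sound _ _ _ _ _ _ _ H Hx Hz zero_face_in Hs).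
    rewrite zero_face_val in K; lra.
Qed.

Lemma faces_lower_check :
  forallb (fun F => forallb (fun v =>
     nonneg (nsub (nadd (fconst F) (nscale (fslope F) v))
                  (nint (Z.b2z (special F) * slack_units))))
     [lo F; hi F]) faces = true.
Proof. vm_compute; reflexivity. Qed.

Lemma fval_lower F x :
  In F faces -> in_face F x -> IZR (Z.b2z (special F)) * slack_unit <= fval F x.
Proof.
  intros HF Hx; assert (H := faces_lower_check).
  rewrite forallb_forall in H; specialize (H F HF); cbn [forallb] in H.
  rewrite !andb_true_iff in H; destruct H as (Hl & Hh & _).
  apply nonneg_sound in Hl; apply nonneg_sound in Hh.
  rewrite val_sub, val_add, val_scale, val_int, mult_IZR, slack_units_val in Hl, Hh.
  assert (Hx' : val (lo F) <= IZR xden * x <= val (hi F))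
    by (unfold in_face in Hx; destruct (is_open F); lra).
  unfold fval; apply (Rmult_le_reg_r (IZR xden * IZR sden)); [unfold xden, sden; lra|].
  replace ((val (fconst F) + IZR (fslope F) * (IZR xden * x)) / (IZR xden * IZR sden)
           * (IZR xden * IZR sden))
    with (val (fconst F) + IZR (fslope F) * (IZR xden * x)) by (field; unfold xden, sden; lra).
  destruct (Rle_or_lt 0 (IZR (fslope F))) as [Hs|Hs].
  - assert (IZR (fslope F) * val (lo F) <= IZR (fslope F) * (IZR xden * x))
      by (apply Rmult_le_compat_l; lra); lra.
  - assert (0 <= - IZR (fslope F) * (val (hi F) - IZR xden * x))
      by (apply Rmult_le_pos; lra); lra.
Qed.

Lemma pi_fun_nonneg x : 0 <= pi_fun x.
Proof.
  destruct (faces_cover x) as (F & HF & Hx & ->).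
  eapply Rle_trans; [|apply fval_lower; eassumption].
  destruct (special F); unfold slack_unit; simpl; lra.
Qed.

Definition L_face : face := nth 35 faces zero_face.

Lemma L_face_face : In L_face faces.
Proof. apply nth_In; vm_compute; lia. Qed.

Lemma mirror_face F : In F left_faces -> In (mirror F) faces.
Proof. intros H; apply in_or_app; right; apply in_or_app; left; now apply in_map. Qed.

Lemma L_face_left : In L_face left_faces.
Proof. change L_face with (nth 35 left_faces zero_face); apply nth_In; vm_compute; lia. Qed.

Lemma L_face_iff x : in_face L_face x <-> in_L x.
Proof.
  unfold in_face; vm_compute (L_face). cbn [is_open lo hi]; unfold val, in_L, xden; simpl; lra.
Qed.

(** * Perturbations, and validity *)

Lemma special_faces F x : In F faces -> in_face F x ->
  (special F = true <-> in_L x \/ in_L (f - x)).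
Proof.
  intros HF Hx.
  assert (HM : in_L (f - x) -> in_face (mirror L_face) x).
  { intros H; replace x with (f - (f - x)) by ring; now apply mirror_in, L_face_iff. }
  split.
  - intros Hs.
    assert (Hc : forallb (fun F => if special F then
       face_eqb F L_face || face_eqb F (mirror L_face) else true) faces = true)
      by (vm_compute; reflexivity).
    rewrite forallb_forall in Hc; specialize (Hc F HF); rewrite Hs in Hc.
    apply orb_true_iff in Hc; destruct Hc as [Hc|Hc]; apply face_eqb_eq in Hc; subst F.
    + left; now apply L_face_iff.
    + right. apply L_face_iff.
      assert (K := mirror_in _ _ Hx).
      replace (mirror (mirror L_face)) with L_face in K by (vm_compute; reflexivity).
      assumption.
  - intros [Hs|Hs].
    + apply L_face_iff in Hs.
      rewrite (faces_disjoint F L_face x) by auto using L_face_face; reflexivity.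
    + rewrite (faces_disjoint F (mirror L_face) x)
        by auto using mirror_face, L_face_left; reflexivity.
Qed.

Definition face_at (i : nat) : face := nth i faces zero_face.

Lemma face_at_face i : (i < 82)%nat -> In (face_at i) faces.
Proof. intros H; apply nth_In; exact H. Qed.

Ltac face_lra :=
  unfold in_face;
  match goal with |- context [is_open ?F] =>
    let G := eval vm_compute in F in change F with G end;
  cbn [is_open lo hi]; unfold val, xden, f in *; cbn [fst snd];
  pose proof sqrt2_bounds; lra.

Definition anchor_faces : list face := map face_at [12; 20; 26]%nat.

Lemma anchor_face a : anchor a -> exists F, In F anchor_faces /\ in_face F a.
Proof.
  intros [->|[->| ->]];
    [exists (face_at 12)|exists (face_at 20)|exists (face_at 26)];
    (split; [simpl; tauto|face_lra]).
Qed.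

Lemma anchor_check :
  forallb (fun F => negb (special F) && tight_at (rat (4#5)) F L_face L_face)
    anchor_faces = true.
Proof. vm_compute; reflexivity. Qed.

Lemma anchor_faces_incl F : In F anchor_faces -> In F faces.
Proof.
  intros H; apply in_map_iff in H; destruct H as (i & <- & Hi).
  apply face_at_face; simpl in Hi; lia.
Qed.

Lemma pi_fun_anchor a y z :
  anchor a -> in_L y -> in_L z -> a + y + z = f ->
  pi_fun a + pi_fun y + pi_fun z = 1.
Proof.
  intros Ha Hy Hz Hs; destruct (anchor_face a Ha) as (F & HF & Hin).
  assert (K := anchor_check); rewrite forallb_forall in K; specialize (K F HF).
  apply andb_true_iff in K; destruct K as [_ K].
  rewrite (pi_fun_face F a), (pi_fun_face L_face y), (pi_fun_face L_face z);
    try apply L_face_face; try (now apply L_face_iff); try assumption;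
    [|now apply anchor_faces_incl].
  eapply tight_at_sound; [exact K|..]; try (now apply L_face_iff); try assumption.
  rewrite Hs; symmetry; apply val_rat_f.
Qed.

Lemma frac_part_sum x y z k : x + y + z = f + IZR k ->
  exists k', frac_part x + frac_part y + frac_part z = f + IZR k'.
Proof.
  intros H; exists (k - Int_part x - Int_part y - Int_part z)%Z.
  unfold frac_part; rewrite !minus_IZR; lra.
Qed.

Lemma linked_zero_sum (p : R -> R) x y z k :
  p 0 = 0 ->
  (forall x z k, x + z = f + IZR k -> p x + p z = 0) ->
  (forall a, anchor a -> p a = 0) ->
  (forall a y z, anchor a -> in_L y -> in_L z -> a + y + z = f -> p y + p z = 0) ->
  x + y + z = f + IZR k -> perm3 linked x y z -> p x + p y + p z = 0.
Proof.
  intros P0 Psym Pa PL.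
  assert (Hl : forall x y z k, x + y + z = f + IZR k -> linked x y z ->
            p x + p y + p z = 0).
  { clear x y z k; intros x y z k Hk [->|(Ha & Hy & Hz)].
    - rewrite P0; rewrite Rplus_0_l; apply (Psym y z k); lra.
    - rewrite (Pa x Ha); rewrite Rplus_0_l; apply (PL x); try assumption.
      assert (k = 0)%Z; [|subst; simpl in Hk; lra].
      unfold anchor, in_L, f in *; pose proof sqrt2_bounds.
      assert (K : -1 < IZR k < 1) by (destruct Ha as [->|[->| ->]]; lra).
      destruct K as [K1 K2]; apply lt_IZR in K1; apply lt_IZR in K2; lia. }
  intros Hk [H|[H|H]]; apply Hl with (k := k) in H; lra.
Qed.

Lemma pi_fun_linked x y z k :
  x + y + z = f + IZR k -> perm3 linked x y z -> pi_fun x + pi_fun y + pi_fun z = 1.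
Proof.
  assert (Hl : forall x y z k, x + y + z = f + IZR k -> linked x y z ->
            pi_fun x + pi_fun y + pi_fun z = 1).
  { clear x y z k; intros x y z k Hk [->|(Ha & Hy & Hz)].
    - rewrite pi_fun_0, Rplus_0_l; apply (pi_fun_sym y z k); lra.
    - apply pi_fun_anchor; try assumption.
      assert (k = 0)%Z; [|subst; simpl in Hk; lra].
      unfold anchor, in_L, f in *; pose proof sqrt2_bounds.
      assert (K : -1 < IZR k < 1) by (destruct Ha as [->|[->| ->]]; lra).
      destruct K as [K1 K2]; apply lt_IZR in K1; apply lt_IZR in K2; lia. }
  intros Hk [H|[H|H]]; apply Hl with (k := k) in H; lra.
Qed.

(** The functions that can be added to [pi_fun] without losing validity:
    [pert_anchor] makes them cancel in the linked triples, and [pert_bound]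
    keeps them within the slack of all others. *)
Record perturbation (p : R -> R) : Prop := {
  pert_shift : forall x k, p (x + IZR k) = p x;
  pert_bound : forall x, Rabs (p x) <= slack_unit;
  pert_off : forall F x, In F faces -> in_face F x -> special F = false -> p x = 0;
  pert_sym : forall x z k, x + z = f + IZR k -> p x + p z = 0;
  pert_anchor : forall a y z,
    anchor a -> in_L y -> in_L z -> a + y + z = f -> p y + p z = 0 }.

Lemma pert_frac p x : perturbation p -> p (frac_part x) = p x.
Proof.
  intros Hp; unfold frac_part.
  replace (x - IZR (Int_part x)) with (x + IZR (- Int_part x))
    by (rewrite opp_IZR; ring).
  now apply pert_shift.
Qed.

Lemma pert_face_bound p F x : perturbation p -> In F faces -> in_face F x ->
  Rabs (p x) <= IZR (Z.b2z (special F)) * slack_unit.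
Proof.
  intros Hp HF Hx; destruct (special F) eqn:Hs.
  - simpl; rewrite Rmult_1_l; now apply pert_bound.
  - rewrite (pert_off p Hp F x), Rabs_R0 by assumption; simpl; lra.
Qed.

Lemma pert_anchor_zero p a : perturbation p -> anchor a -> p a = 0.
Proof.
  intros Hp Ha; destruct (anchor_face a Ha) as (F & HF & Hin).
  assert (K := anchor_check); rewrite forallb_forall in K; specialize (K F HF).
  apply andb_true_iff in K; destruct K as [K _].
  apply (pert_off p Hp F); [now apply anchor_faces_incl|assumption|].
  now apply negb_true_iff.
Qed.

Lemma pert_zero p : perturbation p -> p 0 = 0.
Proof.
  intros Hp; apply (pert_off p Hp zero_face);
    [apply zero_face_face|apply zero_face_in|reflexivity].
Qed.

Lemma triple_cases x y z k : x + y + z = f + IZR k ->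
  exists F G H, (In F faces /\ in_face F (frac_part x) /\ pi_fun x = fval F (frac_part x))
   /\ (In G faces /\ in_face G (frac_part y) /\ pi_fun y = fval G (frac_part y))
   /\ (In H faces /\ in_face H (frac_part z) /\ pi_fun z = fval H (frac_part z))
   /\ (roomy F G H (frac_part x) (frac_part y) (frac_part z)
       \/ perm3 linked (frac_part x) (frac_part y) (frac_part z)).
Proof.
  intros Hk.
  destruct (faces_cover x) as (F & HF & Hx & Ex).
  destruct (faces_cover y) as (G & HG & Hy & Ey).
  destruct (faces_cover z) as (H & HH & Hz & Ez).
  destruct (frac_part_sum x y z k Hk) as (k' & Hk').
  exists F, G, H; repeat (split; [auto|]).
  apply (faces_triple_slack F G H HF HG HH _ _ _ k'); eauto using faces_range.
Qed.

Lemma pi_fun_frac x : pi_fun (frac_part x) = pi_fun x.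
Proof.
  unfold pi_fun; rewrite (frac_part_id (frac_part x)); [reflexivity|].
  destruct (base_fp x); lra.
Qed.

(** In a linked triple the perturbation contributes 0. In any other triple it
    contributes at most [slack_unit] per special point, which is the room that
    the table provides. *)
Lemma pi_fun_perturbed p : perturbation p -> minimal (fun x => pi_fun x + p x).
Proof.
  intros Hp; split.
  - intros x; destruct (faces_cover x) as (F & HF & Hx & ->).
    rewrite <- (pert_frac p x Hp).
    assert (K := pert_face_bound p F _ Hp HF Hx).
    assert (K' := fval_lower F _ HF Hx).
    assert (K2 := Rle_abs (- p (frac_part x))); rewrite Rabs_Ropp in K2; lra.
  - rewrite pi_fun_0, (pert_zero p Hp); lra.
  - intros x z k Hk; assert (K := pert_sym p Hp x z k Hk);
      assert (K' := pi_fun_sym x z k Hk); lra.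
  - intros x y z k Hk.
    destruct (triple_cases x y z k Hk)
      as (F & G & H & (HF & Hx & Ex) & (HG & Hy & Ey) & (HH & Hz & Ez) & [Hr|Hl]).
    + rewrite <- (pert_frac p x Hp), <- (pert_frac p y Hp), <- (pert_frac p z Hp),
        Ex, Ey, Ez.
      assert (KF := pert_face_bound p F _ Hp HF Hx).
      assert (KG := pert_face_bound p G _ Hp HG Hy).
      assert (KH := pert_face_bound p H _ Hp HH Hz).
      assert (K1 := Rle_abs (- p (frac_part x))); rewrite Rabs_Ropp in K1.
      assert (K2 := Rle_abs (- p (frac_part y))); rewrite Rabs_Ropp in K2.
      assert (K3 := Rle_abs (- p (frac_part z))); rewrite Rabs_Ropp in K3.
      destruct Hr as [Hr _]; unfold special_count in Hr; rewrite !plus_IZR in Hr; lra.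
    + destruct (frac_part_sum x y z k Hk) as (k' & Hk').
      assert (K := linked_zero_sum p _ _ _ k' (pert_zero p Hp) (pert_sym p Hp)
        (fun a => pert_anchor_zero p a Hp) (pert_anchor p Hp) Hk' Hl).
      rewrite !(pert_frac p _ Hp) in K.
      assert (K' := pi_fun_linked _ _ _ k' Hk' Hl).
      rewrite !pi_fun_frac in K'; lra.
Qed.

(** The zero perturbation turns the previous lemma into the validity of
    [pi_fun]. *)
Lemma no_perturbation : perturbation (fun _ => 0).
Proof.
  split; intros; try rewrite Rabs_R0; unfold slack_unit; lra.
Qed.

Lemma pi_fun_minimal : minimal pi_fun.
Proof.
  destruct (pi_fun_perturbed _ no_perturbation) as [H0 H1 H2 H3].
  split; intros.
  - specialize (H0 x); lra.
  - lra.
  - specialize (H2 x z k H); lra.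
  - specialize (H3 x y z k H); lra.
Qed.

(** * The perturbation along cosets of a dense group *)

(** Infinite descent: if [m m = 2 n n] then [m = 2 a] and [n n = 2 a a]. *)
Lemma square_twice_square (m n : Z) : (m * m = 2 * (n * n) -> n = 0)%Z.
Proof.
  remember (Z.abs_nat n) as k eqn:Hk; revert m n Hk.
  induction k as [k IH] using lt_wf_ind; intros m n -> H.
  destruct (Z.eq_dec n 0) as [|Hn]; [assumption|exfalso].
  destruct (Z.Even_or_Odd m) as [[a ->]|[a ->]]; [|nia].
  assert (Ha : (n * n = 2 * (a * a))%Z) by nia.
  assert (Hlt : (Z.abs_nat a < Z.abs_nat n)%nat).
  { enough (Z.abs a < Z.abs n)%Z by lia.
    destruct (Z.lt_ge_cases (Z.abs a) (Z.abs n)) as [|Hge]; [assumption|exfalso].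
    assert (Z.abs n * Z.abs n <= Z.abs a * Z.abs a)%Z
      by (apply Z.mul_le_mono_nonneg; lia).
    rewrite !Z.abs_square in *; assert (0 < n * n)%Z by nia; lia. }
  assert (a = 0)%Z by (apply (IH _ Hlt n a eq_refl Ha)); subst; lia.
Qed.

Lemma sqrt2_free (m n : Z) : IZR m + IZR n * sqrt 2 = 0 -> m = 0%Z /\ n = 0%Z.
Proof.
  intros H.
  assert (Hn : n = 0%Z).
  { apply (square_twice_square m n), eq_IZR; rewrite !mult_IZR.
    assert (S := sqrt_sqrt 2 ltac:(lra)).
    replace (IZR m) with (- (IZR n * sqrt 2)) by lra.
    transitivity (IZR n * IZR n * (sqrt 2 * sqrt 2)); [ring|rewrite S; ring]. }
  subst; split; [apply eq_IZR; lra|reflexivity].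
Qed.

(** The group generated by the differences of the anchors; it is dense because
    the square root of 2 is irrational. *)
Definition lattice (t : R) : Prop :=
  exists m n : Z, t = IZR m * (77 / 7752 * sqrt 2) + IZR n * (77 / 2584).

Lemma lattice_add s t : lattice s -> lattice t -> lattice (s + t).
Proof.
  intros (m & n & ->) (m' & n' & ->); exists (m + m')%Z, (n + n')%Z.
  rewrite !plus_IZR; ring.
Qed.

Lemma lattice_opp t : lattice t -> lattice (- t).
Proof.
  intros (m & n & ->); exists (- m)%Z, (- n)%Z; rewrite !opp_IZR; ring.
Qed.

Lemma anchor_lattice a : anchor a -> lattice (a - 19 / 100).
Proof.
  intros [->|[->| ->]]; [exists 0%Z, 0%Z|exists 1%Z, 0%Z|exists 0%Z, 1%Z]; lra.
Qed.

(** The centre of [L] shifted by a sixth of the generator 77/2584. Twice the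
    shift is then a third of that generator, which is not in the lattice. *)
Definition base_point : R := 61 / 200 + 77 / 15504.

(** In units of 77/7752 the lattice is [3 Z + sqrt 2 Z], which does not contain
    1. *)
Lemma base_point_not_reflected : ~ lattice (2 * base_point - 61 / 100).
Proof.
  intros (m & n & H); unfold base_point in H.
  destruct (sqrt2_free (3 * n - 1) m) as [K _]; [|lia].
  rewrite minus_IZR, mult_IZR; lra.
Qed.

(** [1] on the coset of [base_point], [-1] on its image under [r -> 61/100 - r],
    the reflection at the anchor 19/100. *)
Definition coset_sign (r : R) : R :=
  if excluded_middle_informative (lattice (r - base_point)) then 1
  else if excluded_middle_informative (lattice (61 / 100 - r - base_point)) then -1
  else 0.

(** The reflections at the other anchors differ from the first one by lattice
    translations, so all of them exchange the two cosets. *)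
Lemma coset_sign_reflect a r z : anchor a -> a + r + z = f ->
  coset_sign r + coset_sign z = 0.
Proof.
  intros Ha Hz; apply anchor_lattice in Ha; set (s := a - 19 / 100) in Ha.
  assert (Ez : z = 61 / 100 - s - r) by (unfold s, f in *; lra).
  assert (H1 : lattice (z - base_point) <-> lattice (61 / 100 - r - base_point)).
  { split; intros H.
    - replace (61 / 100 - r - base_point) with (z - base_point + s) by lra.
      now apply lattice_add.
    - replace (z - base_point) with (61 / 100 - r - base_point + - s) by lra.
      now apply lattice_add, lattice_opp. }
  assert (H2 : lattice (61 / 100 - z - base_point) <-> lattice (r - base_point)).
  { split; intros H.
    - replace (r - base_point) with (61 / 100 - z - base_point + - s) by lra.
      now apply lattice_add, lattice_opp.
    - replace (61 / 100 - z - base_point) with (r - base_point + s) by lra.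
      now apply lattice_add. }
  assert (H3 : ~ (lattice (r - base_point) /\ lattice (61 / 100 - r - base_point))).
  { intros [K1 K2]; apply base_point_not_reflected.
    replace (2 * base_point - 61 / 100)
      with (- (r - base_point + (61 / 100 - r - base_point))) by lra.
    now apply lattice_opp, lattice_add. }
  unfold coset_sign.
  repeat destruct excluded_middle_informative; try lra; tauto.
Qed.

Lemma coset_sign_bound r : Rabs (coset_sign r) <= 1.
Proof.
  unfold coset_sign; repeat destruct excluded_middle_informative;
    apply Rabs_le; lra.
Qed.

(** The extension from [L] to its mirror image that is odd under [x -> f - x]. *)
Definition coset_unit (r : R) : R :=
  if excluded_middle_informative (in_L r) then coset_sign r
  else if excluded_middle_informative (in_L (f - r)) then - coset_sign (f - r)
  else 0.

Definition coset_pert (c : R) (x : R) : R := c * coset_unit (frac_part x).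

Lemma coset_pert_perturbation c : Rabs c <= slack_unit -> perturbation (coset_pert c).
Proof.
  intros Hc; unfold coset_pert; split.
  - intros x k; now rewrite frac_part_shift.
  - intros x; rewrite Rabs_mult.
    apply Rle_trans with (Rabs c * 1); [|lra].
    apply Rmult_le_compat_l; [apply Rabs_pos|]; unfold coset_unit.
    repeat destruct excluded_middle_informative;
      rewrite ?Rabs_Ropp, ?Rabs_R0; try apply coset_sign_bound; lra.
  - intros F x HF Hx Hs.
    rewrite (frac_part_id x (faces_range F x HF Hx)).
    assert (K := special_faces F x HF Hx); rewrite Hs in K.
    unfold coset_unit; repeat destruct excluded_middle_informative; try lra;
      exfalso; assert (false = true) by tauto; discriminate.
  - intros x z k Hk; rewrite <- Rmult_plus_distr_l.
    destruct (base_fp x) as [X0 X1]; destruct (base_fp z) as [Z0 Z1].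
    assert (Hk' : exists k', frac_part x + frac_part z = f + IZR k').
    { exists (k - Int_part x - Int_part z)%Z; unfold frac_part.
      rewrite !minus_IZR; lra. }
    destruct Hk' as (k' & Hk').
    set (r := frac_part x) in *; set (s := frac_part z) in *; clearbody r s.
    enough (coset_unit r + coset_unit s = 0) as -> by ring.
    assert (Hf : in_L r \/ in_L (f - r) \/ in_L s \/ in_L (f - s) -> s = f - r).
    { intros H; assert (k' = 0%Z); [|subst; lra].
      unfold in_L, f in *; assert (K : -1 < IZR k' < 1) by lra.
      destruct K as [K1 K2]; apply lt_IZR in K1; apply lt_IZR in K2; lia. }
    unfold coset_unit.
    destruct (excluded_middle_informative (in_L r)) as [I1|I1];
    destruct (excluded_middle_informative (in_L (f - r))) as [I2|I2];
    destruct (excluded_middle_informative (in_L s)) as [I3|I3];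
    destruct (excluded_middle_informative (in_L (f - s))) as [I4|I4];
    try (assert (Hs : s = f - r) by (apply Hf; tauto));
    try lra; try (unfold in_L, f in *; lra).
    + replace (f - s) with r by lra; lra.
    + replace s with (f - r) by lra; lra.
  - intros a y z Ha Hy Hz Hs.
    rewrite !frac_part_id by (unfold in_L in *; lra).
    unfold coset_unit.
    destruct (excluded_middle_informative (in_L y)) as [_|N]; [|contradiction].
    destruct (excluded_middle_informative (in_L z)) as [_|N]; [|contradiction].
    rewrite <- Rmult_plus_distr_l, (coset_sign_reflect a y z Ha Hs); ring.
Qed.

Lemma coset_pert_base c : coset_pert c base_point = c.
Proof.
  unfold coset_pert; rewrite frac_part_id by (unfold base_point; lra).
  unfold coset_unit, coset_sign.
  destruct (excluded_middle_informative (in_L base_point)) as [_|N];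
    [|exfalso; apply N; unfold in_L, base_point; lra].
  destruct (excluded_middle_informative (lattice (base_point - base_point))) as [_|N]; [ring|].
  exfalso; apply N; exists 0%Z, 0%Z; lra.
Qed.

Lemma pi_fun_not_extreme : ~ extreme pi_fun.
Proof.
  intros [_ H].
  assert (Hc : forall c, Rabs c <= slack_unit -> valid (fun x => pi_fun x + coset_pert c x))
    by (intros c ?; now apply minimal_valid, pi_fun_perturbed, coset_pert_perturbation).
  assert (Hp : 0 < slack_unit) by (unfold slack_unit; lra).
  destruct (H _ _ (Hc slack_unit ltac:(rewrite Rabs_pos_eq; lra))
                  (Hc (- slack_unit) ltac:(rewrite Rabs_Ropp, Rabs_pos_eq; lra)))
    as [H1 _].
  - intros x; unfold coset_pert; lra.
  - specialize (H1 base_point); rewrite coset_pert_base in H1; lra.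
Qed.

(** If [g] is the mean of two valid functions, then a multiset tight for [g] is
    tight for both. *)
Lemma facet_extreme g : facet g -> extreme g.
Proof.
  intros [Hv Hf]; split; [assumption|]; intros g1 g2 H1 H2 Hg.
  assert (Hl : forall l, lsum g l = 1 / 2 * (lsum g1 l + lsum g2 l)).
  { unfold lsum; induction l as [|a l IH]; simpl; [lra|]; rewrite IH, Hg; lra. }
  assert (Ht : forall y, tight g y -> tight g1 y /\ tight g2 y).
  { intros y [Hy Hs]; rewrite fsum_entries, Hl in Hs.
    assert (K1 := proj2 H1 y Hy); assert (K2 := proj2 H2 y Hy).
    rewrite fsum_entries in K1, K2.
    split; (split; [assumption|]); rewrite fsum_entries; lra. }
  assert (E1 : forall x, g1 x = g x) by (apply Hf; [assumption|apply Ht]).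
  assert (E2 : forall x, g2 x = g x) by (apply Hf; [assumption|apply Ht]).
  split; intros x; rewrite ?E1, ?E2; reflexivity.
Qed.

(** * Bounded additive functions *)

(** The archimedean property, in the form used for additive functions. *)
Lemma bounded_multiples_zero e K :
  (forall n, (0 < n)%nat -> INR n * Rabs e <= K) -> e = 0.
Proof.
  intros H; destruct (Req_dec e 0) as [|He]; [assumption|exfalso].
  assert (Hp := Rabs_pos_lt e He).
  destruct (archimed (K / Rabs e)) as [Hu _].
  assert (HK : 0 <= K) by (specialize (H 1%nat ltac:(lia)); simpl in H; lra).
  assert (Hq : 0 <= K / Rabs e) by (apply Rdiv_le_0_compat; lra).
  assert (Hz : (0 < up (K / Rabs e))%Z) by (apply lt_IZR; lra).
  specialize (H (Z.to_nat (up (K / Rabs e))) ltac:(lia)).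
  rewrite INR_IZR_INZ, Z2Nat.id in H by lia.
  apply (Rmult_lt_compat_r (Rabs e)) in Hu; [|assumption].
  replace (K / Rabs e * Rabs e) with K in Hu by (field; lra); lra.
Qed.

(** Subtract the linear function that agrees with [phi] at [w / 2]. The rest [e]
    vanishes at all multiples of [u = w / 2n], so its values are those on [0,
    u), where [n] multiples still fit and boundedness gives [|e| <= K' / n]. *)
Lemma additive_bounded_linear (phi : R -> R) w K :
  0 < w -> (forall t, 0 <= t < w -> Rabs (phi t) <= K) ->
  (forall s t, 0 <= s -> 0 <= t -> s + t < w -> phi (s + t) = phi s + phi t) ->
  exists sigma, forall t, 0 <= t < w -> phi t = sigma * t.
Proof.
  intros Hw Hb Ha.
  set (t0 := w / 2); set (sigma := phi t0 / t0); exists sigma.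
  set (e := fun t => phi t - sigma * t).
  assert (e_add : forall s t, 0 <= s -> 0 <= t -> s + t < w -> e (s + t) = e s + e t)
    by (intros s t Hs Ht Hst; unfold e; rewrite Ha by assumption; ring).
  assert (e_t0 : e t0 = 0) by (unfold e, sigma; field; unfold t0; lra).
  set (K' := K + Rabs sigma * w).
  assert (e_bound : forall t, 0 <= t < w -> Rabs (e t) <= K').
  { intros t Ht; unfold e, K', Rminus.
    eapply Rle_trans; [apply Rabs_triang|].
    apply Rplus_le_compat; [now apply Hb|]; rewrite Rabs_Ropp, Rabs_mult.
    apply Rmult_le_compat_l; [apply Rabs_pos|]; rewrite Rabs_pos_eq; lra. }
  assert (e_mult : forall n t, 0 <= t -> INR n * t < w -> e (INR n * t) = INR n * e t).
  { induction n as [|n IH]; intros t Ht Hn.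
    - simpl; rewrite !Rmult_0_l.
      assert (E0 := e_add 0 0 ltac:(lra) ltac:(lra) ltac:(lra)).
      rewrite Rplus_0_l in E0; lra.
    - rewrite S_INR in *; rewrite !Rmult_plus_distr_r, !Rmult_1_l in *.
      assert (0 <= INR n * t) by (apply Rmult_le_pos; [apply pos_INR|assumption]).
      rewrite e_add, IH by lra; reflexivity. }
  intros t Ht; enough (e t = 0) by (unfold e in *; lra).
  apply (bounded_multiples_zero _ K'); intros n Hn.
  assert (Hn' : 0 < INR n) by (apply lt_0_INR; lia).
  set (u := t0 / INR n).
  assert (Hu : 0 < u) by (apply Rdiv_lt_0_compat; unfold t0; lra).
  assert (Hnu : INR n * u = t0) by (unfold u; field; lra).
  assert (e_u : e u = 0).
  { assert (E := e_mult n u ltac:(lra) ltac:(rewrite Hnu; unfold t0; lra)).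
    rewrite Hnu, e_t0 in E; symmetry in E; apply Rmult_integral in E; lra. }
  (* Modulo [u], on whose multiples [e] vanishes, [t] is some [r < u]. *)
  destruct (base_fp (t / u)) as [F0 F1]; set (r := frac_part (t / u)) in *.
  assert (Hm : (0 <= Int_part (t / u))%Z).
  { enough (-1 < Int_part (t / u))%Z by lia; apply lt_IZR.
    assert (0 <= t / u) by (apply Rdiv_le_0_compat; lra).
    unfold r, frac_part in F1; lra. }
  set (m := Z.to_nat (Int_part (t / u))).
  assert (Htr : t = INR m * u + r * u).
  { unfold m, r, frac_part; rewrite INR_IZR_INZ, Z2Nat.id by assumption; field; lra. }
  assert (Hr : 0 <= r * u < u).
  { split; [apply Rmult_le_pos; lra|].
    replace u with (1 * u) at 2 by ring; apply Rmult_lt_compat_r; lra. }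
  assert (Hmu : 0 <= INR m * u) by (apply Rmult_le_pos; [apply pos_INR|lra]).
  assert (e_r : e t = e (r * u)).
  { rewrite Htr, e_add, e_mult, e_u by lra; ring. }
  assert (Hnr : INR n * (r * u) <= t0)
    by (rewrite <- Hnu; apply Rmult_le_compat_l; lra).
  assert (Hnr0 : 0 <= INR n * (r * u)) by (apply Rmult_le_pos; lra).
  assert (Ht0 : t0 < w) by (unfold t0; lra).
  rewrite e_r, <- (Rabs_pos_eq (INR n)), <- Rabs_mult, <- e_mult by lra.
  apply e_bound; lra.
Qed.

(** The increments of [g] from a base point [x0] form an additive function near
    0, since [g (x0 + s) + g (x0 + t) = g (2 x0 + s + t)] depends on [s + t]
    only. The condition [4 a < b] leaves room for a base point with [2 x0 < b /
    2]. *)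
Lemma window_additive_linear (g : R -> R) a b K :
  0 <= a -> 4 * a < b -> (forall x, a < x < b -> Rabs (g x) <= K) ->
  (forall x y, a < x -> a < y -> x + y < b -> g (x + y) = g x + g y) ->
  exists sigma, forall x, a < x < b -> g x = sigma * x.
Proof.
  intros Ha Hab Hb Hg.
  set (x0 := (a + b / 4) / 2).
  assert (H0 : a < x0 /\ 2 * x0 < b / 2) by (unfold x0; lra); clearbody x0.
  destruct (additive_bounded_linear (fun t => g (x0 + t) - g x0) (b / 2 - x0) (K + K))
    as [sigma Hs]; [lra| | |].
  - intros t Ht; unfold Rminus; eapply Rle_trans; [apply Rabs_triang|].
    rewrite Rabs_Ropp; apply Rplus_le_compat; apply Hb; lra.
  - intros s t Hs Ht Hst.
    assert (E1 := Hg (x0 + s) (x0 + t) ltac:(lra) ltac:(lra) ltac:(lra)).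
    assert (E2 := Hg x0 (x0 + (s + t)) ltac:(lra) ltac:(lra) ltac:(lra)).
    replace (x0 + (x0 + (s + t))) with (x0 + s + (x0 + t)) in E2 by ring; lra.
  - assert (Hmid : forall x, x0 <= x < b / 2 -> g x = g x0 + sigma * (x - x0)).
    { intros x Hx; specialize (Hs (x - x0) ltac:(lra)); cbn beta in Hs.
      replace (x0 + (x - x0)) with x in Hs by ring; lra. }
    assert (Hx0 : g x0 = sigma * x0).
    { assert (E := Hg x0 x0 ltac:(lra) ltac:(lra) ltac:(lra)).
      assert (E' := Hmid (x0 + x0) ltac:(lra)); lra. }
    exists sigma; intros x Hx.
    destruct (Rlt_or_le x x0) as [H1|H1].
    + assert (E := Hg x x0 ltac:(lra) ltac:(lra) ltac:(lra)).
      assert (E' := Hmid (x + x0) ltac:(lra)); lra.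
    + destruct (Rlt_or_le x (b / 2)) as [H2|H2].
      * assert (E' := Hmid x ltac:(lra)); lra.
      * assert (E := Hg (x / 2) (x / 2) ltac:(lra) ltac:(lra) ltac:(lra)).
        replace (x / 2 + x / 2) with x in E by field.
        assert (E' := Hmid (x / 2) ltac:(lra)); lra.
Qed.

(** * Functions with at least the same tight solutions *)

(** The step [(a, b, c, w)]: points of face [c] complete the breakpoint [a] and
    some point of face [b] to a tight triple with sum [f + w]. *)
Definition step : Type := (nat * nat * nat * Z)%type.
Definition known (K : list face) (i : nat) : bool := existsb (face_eqb (face_at i)) K.
Definition target_at (w : Z) : num := nint ((800 + 1000 * w) * coarse).

(** The condition with [within] says that [f + w - a - z] lies in face [b] for
    all [z] in face [c]. *)
Definition step_ok (K : list face) (s : step) : bool :=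
  let '(a, b, c, w) := s in
  let A := face_at a in let B := face_at b in let C := face_at c in
  let t := nsub (target_at w) (lo A) in
  let within := if is_open B && negb (is_open C) then pos else nonneg in
  known K a && known K b && num_eqb (lo A) (hi A) && negb (is_open A)
  && tight_at (target_at w) A B C
  && within (nsub (nsub t (hi C)) (lo B)) && within (nsub (hi B) (nsub t (lo C))).

(** An invalid step yields the empty list, so nothing can be concluded from it. *)
Fixpoint run (l : list step) (K : list face) : list face :=
  match l with
  | [] => K
  | s :: l' =>
      if step_ok K s then
        let C := face_at (snd (fst s)) in run l' (C :: mirror C :: K)
      else []
  end.

Lemma val_target_at w : val (target_at w) = IZR xden * (f + IZR w).
Proof.
  unfold target_at; rewrite val_int, mult_IZR, plus_IZR, mult_IZR.
  unfold coarse, xden, f; lra.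
Qed.

(** The faces on which the difference vanishes by a direct argument. *)
Definition seeds : list nat := [0; 1; 2; 3; 4; 12; 20; 26; 36; 37; 78; 79; 81]%nat.
Definition steps : list step :=
  [(26, 37, 32, 0%Z); (12, 79, 43, 1%Z); (12, 81, 45, 1%Z); (12, 81, 46, 1%Z);
   (20, 79, 47, 1%Z); (12, 81, 48, 1%Z); (20, 81, 49, 1%Z); (20, 81, 51, 1%Z);
   (20, 81, 52, 1%Z); (26, 79, 53, 1%Z); (12, 1, 54, 0%Z); (26, 81, 55, 1%Z);
   (12, 1, 56, 0%Z); (12, 1, 57, 0%Z); (12, 1, 59, 0%Z); (12, 3, 61, 0%Z);
   (12, 3, 62, 0%Z); (20, 1, 63, 0%Z); (20, 1, 65, 0%Z); (12, 3, 66, 0%Z);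
   (20, 3, 67, 0%Z); (20, 3, 68, 0%Z); (26, 1, 69, 0%Z); (26, 3, 71, 0%Z);
   (26, 3, 72, 0%Z); (0, 81, 77, 1%Z); (0, 78, 80, 1%Z); (52, 3, 6, 0%Z);
   (52, 81, 22, 1%Z)]%nat.

Definition seed_faces : list face :=
  flat_map (fun i => [face_at i; mirror (face_at i)]) seeds.

Lemma steps_cover :
  forallb (fun F => special F || existsb (face_eqb F) (run steps seed_faces)) faces = true.
Proof. vm_compute; reflexivity. Qed.

Definition x2 : R := 60153 / 369200.
Definition a2 : R := 77 / 7752 * sqrt 2 + 19 / 100.
Definition a3 : R := 14199 / 64600.
Definition x12 : R := 1925 / 298129 * sqrt 2 + 1051 / 5000.
Definition x15 : R := 77 / 22152 * sqrt 2 + 342208579 / 1490645000.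

(** The powers of the unit [sqrt 2 - 1] are arbitrarily small elements of [Z + Z
    sqrt 2]. *)
Lemma sqrt2_power_form k : exists a b : Z, (sqrt 2 - 1) ^ k = IZR a + IZR b * sqrt 2.
Proof.
  induction k as [|k (a & b & IH)]; [exists 1%Z, 0%Z; simpl; lra|].
  exists (2 * b - a)%Z, (a - b)%Z; cbn [pow]; rewrite IH.
  rewrite !minus_IZR, mult_IZR; assert (S := sqrt_sqrt 2 ltac:(lra)).
  transitivity (IZR b * (sqrt 2 * sqrt 2) - IZR a + (IZR a - IZR b) * sqrt 2);
    [ring|rewrite S; ring].
Qed.

(** Some multiple of a positive lattice element smaller than [v - u] falls into
    the gap. *)
Lemma lattice_dense u v : u < v -> exists t, lattice t /\ u < t < v.
Proof.
  intros Huv; pose proof sqrt2_bounds as Hr2.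
  destruct (pow_lt_1_zero (sqrt 2 - 1) ltac:(rewrite Rabs_pos_eq; lra) (v - u) ltac:(lra))
    as [N HN].
  specialize (HN N (le_n N)).
  assert (Hp : 0 < (sqrt 2 - 1) ^ N) by (apply pow_lt; lra).
  rewrite Rabs_pos_eq in HN by lra.
  destruct (sqrt2_power_form N) as (a & b & Hab).
  set (del := 77 / 2584 * (sqrt 2 - 1) ^ N).
  assert (Hd : 0 < del < v - u) by (unfold del; lra).
  destruct (archimed (u / del)) as [H1 H2]; set (m := up (u / del)) in *.
  exists (IZR m * del); split.
  - exists (3 * (m * b))%Z, (m * a)%Z; unfold del; rewrite Hab, !mult_IZR; field.
  - apply (Rmult_lt_compat_r del) in H1; [|lra].
    apply (Rmult_le_compat_r del) in H2; [|lra].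
    rewrite Rmult_minus_distr_r in H2.
    replace (u / del * del) with u in H1, H2 by (field; lra); lra.
Qed.

Section Difference.
  Variable g : R -> R.
  Hypothesis Hv : valid g.
  Hypothesis Ht : forall y, tight pi_fun y -> tight g y.

  Let Hg : minimal g := dominated_minimal pi_fun g pi_fun_minimal Hv Ht.
  Let d (x : R) : R := g x - pi_fun x.

  Lemma diff_sym x z k : x + z = f + IZR k -> d x + d z = 0.
  Proof.
    intros H; assert (H1 := min_sym g Hg x z k H).
    assert (H2 := pi_fun_sym x z k H); unfold d; lra.
  Qed.

  Lemma diff_shift x k : d (x + IZR k) = d x.
  Proof.
    unfold d; rewrite (min_shift g Hg), pi_fun_shift; reflexivity.
  Qed.

  Lemma diff_zero : d 0 = 0.
  Proof. unfold d; rewrite (min_zero g Hg), pi_fun_0; ring. Qed.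

  (** Both functions take values in [0, 1], by nonnegativity and symmetry. *)
  Lemma diff_bounded x : Rabs (d x) <= 1.
  Proof.
    assert (A0 := min_nonneg g Hg x); assert (A1 := min_nonneg g Hg (f - x)).
    assert (A2 := min_sym g Hg x (f - x) 0 ltac:(simpl; lra)).
    assert (B0 := pi_fun_nonneg x); assert (B1 := pi_fun_nonneg (f - x)).
    assert (B2 := pi_fun_sym x (f - x) 0 ltac:(simpl; lra)).
    unfold d; apply Rabs_le; lra.
  Qed.

  Lemma diff_tight F G H x y z w :
    In F faces -> In G faces -> In H faces ->
    tight_at (target_at w) F G H = true ->
    in_face F x -> in_face G y -> in_face H z -> x + y + z = f + IZR w ->
    d x + d y + d z = 0.
  Proof.
    intros HF HG HH Htt Hx Hy Hz Hs.
    enough (K : pi_fun x + pi_fun y + pi_fun z = 1).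
    { assert (K' := dominated_triple pi_fun g Ht x y z w Hs K); unfold d; lra. }
    rewrite (pi_fun_face F x), (pi_fun_face G y), (pi_fun_face H z) by assumption.
    eapply tight_at_sound; try eassumption.
    rewrite Hs; symmetry; apply val_target_at.
  Qed.

  Lemma diff_tight_at i j k w x y z :
    tight_at (target_at w) (face_at i) (face_at j) (face_at k) = true ->
    (i < 82)%nat -> (j < 82)%nat -> (k < 82)%nat -> x + y + z = f + IZR w ->
    in_face (face_at i) x -> in_face (face_at j) y -> in_face (face_at k) z ->
    d x + d y + d z = 0.
  Proof. intros; eapply diff_tight; try eassumption; now apply face_at_face. Qed.

  Ltac sum_zero i j k w x y z :=
    refine (diff_tight_at i j k w x y z _ _ _ _ _ _ _ _);
    [vm_compute; reflexivity|lia|lia|lia|unfold f; lra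
    |unfold x2, a2, a3, x12, x15 in *; face_lra..].

  (** On the face to the right of 101/5000 two points and the mirror image of
      their sum form a tight triple, so [d] is additive there. *)
  Lemma diff_linear_left : exists sigma, forall x, 101 / 5000 < x <= x2 -> d x = sigma * x.
  Proof.
    destruct (window_additive_linear d (101 / 5000) x2 1) as [sigma Hs];
      [lra|unfold x2; lra|intros; apply diff_bounded| |].
    - intros x y Hx Hy Hxy.
      assert (E : d x + d y + d (f - (x + y)) = 0)
        by sum_zero 3%nat 3%nat 41%nat 0%Z x y (f - (x + y)).
      assert (E' := diff_sym (x + y) (f - (x + y)) 0 ltac:(simpl; lra)); lra.
    - exists sigma; intros x Hx.
      destruct (Rlt_or_le x x2); [apply Hs; lra|].
      replace x with x2 by lra.
      assert (E : d (x2 / 2) + d (x2 / 2) + d (f - x2) = 0)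
        by sum_zero 3%nat 3%nat 42%nat 0%Z (x2 / 2) (x2 / 2) (f - x2).
      assert (E' := diff_sym x2 (f - x2) 0 ltac:(simpl; lra)).
      rewrite (Hs (x2 / 2)) in E by (unfold x2; lra); lra.
  Qed.

  (** Here [r -> d (1 - r)] is additive, hence linear; by symmetry it vanishes
      at [r = 1/10], because twice 9/10 is [f + 1]. So its slope is 0. *)
  Lemma diff_zero_right x : 4101 / 5000 < x < 4899 / 5000 -> d x = 0.
  Proof.
    destruct (window_additive_linear (fun r => d (1 - r)) (101 / 5000) (899 / 5000) 1)
      as [tau Hs]; [lra|lra|intros; apply diff_bounded| |].
    - intros r s Hr Hs Hrs; cbn beta.
      assert (E : d (1 - r) + d (1 - s) + d (4 / 5 + (r + s)) = 0)
        by sum_zero 79%nat 79%nat 79%nat 2%Z (1 - r) (1 - s) (4 / 5 + (r + s)).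
      assert (E' := diff_sym (1 - (r + s)) (4 / 5 + (r + s)) 1
        ltac:(unfold f; lra)); lra.
    - assert (E := diff_sym (1 - 1 / 10) (1 - 1 / 10) 1 ltac:(unfold f; lra)).
      assert (E' := Hs (1 / 10) ltac:(lra)); cbn beta in E'.
      assert (Htau : tau = 0) by lra.
      intros Hx; assert (E2 := Hs (1 - x) ltac:(lra)); cbn beta in E2.
      replace (1 - (1 - x)) with x in E2 by ring; rewrite E2, Htau; ring.
  Qed.

  (** All values below are multiples of [sigma]. Starting from [a3] and the
      values on (0, 101/5000), tight triples lead via [x15], [a2] and [x12] to
      19/100, where a triple with [x2] gives another value. The two values
      differ by a nonzero multiple of [sigma], so [sigma = 0]. *)
  Lemma diff_slope_zero sigma :
    (forall x, 101 / 5000 < x <= x2 -> d x = sigma * x) ->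
    sigma = 0 /\ d (4101 / 5000) = 0 /\ d (19 / 100) = 0 /\ d a2 = 0 /\ d a3 = 0.
  Proof.
    intros Hs; pose proof sqrt2_bounds as Hr2.
    set (alpha := - d (4101 / 5000)).
    assert (Hx0 : in_face (face_at 37) (f - 2 * a3)) by (unfold a3; face_lra).
    assert (E1 : d (f - 2 * (f - 2 * a3)) + d (f - 2 * a3) + d (f - 2 * a3) = 0)
      by sum_zero 3%nat 37%nat 37%nat 0%Z
        (f - 2 * (f - 2 * a3)) (f - 2 * a3)
        (f - 2 * a3).
    rewrite Hs in E1 by (unfold a3, x2, f; lra).
    assert (E2 : d a3 + d a3 + d (f - 2 * a3) = 0)
      by sum_zero 26%nat 26%nat 37%nat 0%Z
        a3 a3 (f - 2 * a3).
    assert (Hal : forall x, 0 < x < 101 / 5000 -> d x = alpha).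
    { intros x Hx.
      assert (E : d x + d (4101 / 5000) + d (4899 / 5000 - x) = 0)
        by sum_zero 1%nat 78%nat 79%nat 1%Z x (4101 / 5000) (4899 / 5000 - x).
      rewrite (diff_zero_right (4899 / 5000 - x)) in E by lra; unfold alpha; lra. }
    assert (E3 : d (101 / 10000) + d (101 / 10000) + d (3899 / 5000) = 0)
      by sum_zero 1%nat 1%nat 40%nat 0%Z (101 / 10000) (101 / 10000) (3899 / 5000).
    assert (E4 : d (4101 / 5000) + d (9899 / 10000) + d (9899 / 10000) = 0)
      by sum_zero 78%nat 81%nat 81%nat 2%Z (4101 / 5000) (9899 / 10000) (9899 / 10000).
    assert (E5 : d (303 / 10000) + d (3899 / 5000) + d (9899 / 10000) = 0)
      by sum_zero 3%nat 40%nat 81%nat 1%Z (303 / 10000) (3899 / 5000) (9899 / 10000).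
    rewrite Hal in E3 by lra; rewrite Hs in E5 by (unfold x2; lra).
    assert (E6 : d (f - a3 - (f - x15)) + d a3 + d (f - x15) = 0)
      by sum_zero 1%nat 26%nat 68%nat 0%Z
        (f - a3 - (f - x15))
        a3 (f - x15).
    rewrite Hal in E6 by (unfold a3, x15, f; lra).
    assert (E7 : d (x15 - a2) + d a2 + d (f - x15) = 0)
      by sum_zero 3%nat 20%nat 68%nat 0%Z
        (x15 - a2)
        a2
        (f - x15).
    rewrite Hs in E7 by (unfold x15, a2, x2; lra).
    assert (E8 : d (x12 - a2) + d a2 + d (f - x12) = 0)
      by sum_zero 1%nat 20%nat 62%nat 0%Z
        (x12 - a2)
        a2
        (f - x12).
    rewrite Hal in E8 by (unfold x12, a2; lra).
    assert (E9 : d (x12 - 19 / 100) + d (19 / 100) + d (f - x12) = 0)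
      by sum_zero 3%nat 12%nat 62%nat 0%Z
        (x12 - 19 / 100) (19 / 100)
        (f - x12).
    rewrite Hs in E9 by (unfold x12, x2; lra).
    assert (E10 : d (19 / 100) + d (f - x2) + d (81 / 100 + x2) = 0)
      by sum_zero 12%nat 42%nat 79%nat 1%Z (19 / 100)
        (f - x2) (81 / 100 + x2).
    rewrite (diff_zero_right (81 / 100 + x2)) in E10 by (unfold x2; lra).
    assert (E11 := diff_sym x2 (f - x2) 0 ltac:(simpl; lra)).
    rewrite Hs in E11 by (unfold x2; lra).
    assert (Halpha : alpha = 101 / 5000 * sigma) by (unfold alpha in *; lra).
    assert (Hd3 : d a3 = sigma * (a3 - 1 / 5)) by (unfold f in *; lra).
    assert (Hz : sigma * (101 / 2500 + a3 - 1 / 5 - x15 + a2 - x2 - x12 + 19 / 100) = 0)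
      by lra.
    assert (S0 : sigma = 0).
    { apply Rmult_integral in Hz; destruct Hz as [|Hz]; [assumption|exfalso].
      unfold a3, x15, a2, x2, x12 in Hz; lra. }
    subst sigma; unfold alpha in *; repeat split; lra.
  Qed.

  Definition vanishes (F : face) : Prop := forall x, in_face F x -> d x = 0.

  Lemma vanishes_mirror F : vanishes (mirror F) <-> vanishes F.
  Proof.
    split; intros H x Hx.
    - assert (E := diff_sym x (f - x) 0 ltac:(simpl; lra)).
      rewrite (H (f - x)) in E by (now apply mirror_in); lra.
    - assert (E := diff_sym x (f - x) 0 ltac:(simpl; lra)).
      rewrite (H (f - x)) in E; [lra|].
      apply mirror_in in Hx; revert Hx; unfold in_face, mirror; destruct F as [l h o s c].
      cbn [is_open lo hi]; rewrite !val_sub; destruct o; lra.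
  Qed.

  Lemma vanishes_at i x : lo (face_at i) = hi (face_at i) -> is_open (face_at i) = false ->
    IZR xden * x = val (lo (face_at i)) -> d x = 0 -> vanishes (face_at i).
  Proof.
    intros Hl Ho Hx H0 z Hz; unfold in_face in Hz; rewrite Ho, <- Hl in Hz.
    replace z with x; [assumption|]; unfold xden in *; lra.
  Qed.

  Ltac seed_point x :=
    apply (vanishes_at _ x); [reflexivity|reflexivity| |assumption];
    match goal with |- context [lo ?F] =>
      let G := eval vm_compute in F in change F with G end;
    cbn [lo]; unfold val, xden, a2, a3, x2; cbn [fst snd]; lra.

  Ltac seed_open H :=
    intros x Hx; apply H; revert Hx; unfold in_face;
    match goal with |- context [is_open ?F] =>
      let G := eval vm_compute in F in change F with G end;
    cbn [is_open lo hi]; unfold val, xden, x2; cbn [fst snd]; lra.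

  (** With [sigma = 0] the equations of [diff_slope_zero] give zeros on whole
      faces. *)
  Lemma seeds_vanish F : In F seed_faces -> vanishes F.
  Proof.
    pose proof sqrt2_bounds as Hr2.
    destruct diff_linear_left as [sigma Hs].
    destruct (diff_slope_zero sigma Hs) as (-> & H78 & H12 & H20 & H26).
    assert (H3 : forall x, 101 / 5000 < x <= x2 -> d x = 0)
      by (intros x Hx; rewrite Hs by assumption; ring).
    assert (H1 : forall x, 0 < x < 101 / 5000 -> d x = 0).
    { intros x Hx.
      assert (E : d x + d (4101 / 5000) + d (4899 / 5000 - x) = 0)
        by sum_zero 1%nat 78%nat 79%nat 1%Z x (4101 / 5000) (4899 / 5000 - x).
      rewrite (diff_zero_right (4899 / 5000 - x)) in E by lra; lra. }
    assert (H40 : d (3899 / 5000) = 0).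
    { assert (E : d (101 / 10000) + d (101 / 10000) + d (3899 / 5000) = 0)
        by sum_zero 1%nat 1%nat 40%nat 0%Z (101 / 10000) (101 / 10000) (3899 / 5000).
      rewrite H1 in E by lra; lra. }
    assert (H2 : d (101 / 5000) = 0).
    { assert (E := diff_sym (101 / 5000) (3899 / 5000) 0 ltac:(unfold f; lra)); lra. }
    assert (H81 : forall x, 4899 / 5000 < x < 1 -> d x = 0).
    { intros x Hx.
      assert (E : d (5101 / 5000 - x) + d (3899 / 5000) + d x = 0)
        by sum_zero 3%nat 40%nat 81%nat 1%Z (5101 / 5000 - x) (3899 / 5000) x.
      rewrite H3 in E by (unfold x2; lra); lra. }
    (* On the central face, [d] takes equal values at points at distance
       between 101/5000 and 3/25, and it is odd about 2/5. *)
    assert (Hmove : forall x y, 269 / 800 < x -> y < 371 / 800 ->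
              101 / 5000 < y - x < 3 / 25 -> d x = d y).
    { intros x y Hx Hy Hxy.
      assert (E : d (y - x) + d x + d (f - y) = 0)
        by sum_zero 3%nat 37%nat 37%nat 0%Z (y - x) x (f - y).
      assert (E' := diff_sym y (f - y) 0 ltac:(simpl; lra)).
      rewrite H3 in E by (unfold x2; lra); lra. }
    assert (H37 : forall x, 269 / 800 < x < 371 / 800 -> d x = 0).
    { assert (Hfar : forall x, 269 / 800 < x < 1949 / 5000 -> d x = 0).
      { intros x Hx; unfold f in *.
        assert (E' := diff_sym x (f - x) 0 ltac:(simpl; lra)).
        destruct (Rlt_or_le x (341 / 1000)) as [Hc|Hc].
        - assert (E1 := Hmove x (x + 4 / 100) ltac:(lra) ltac:(lra) ltac:(lra)).
          assert (E2 := Hmove (x + 4 / 100) (4 / 5 - (x + 4 / 100))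
            ltac:(lra) ltac:(lra) ltac:(lra)).
          assert (E3 := diff_sym (x + 4 / 100) (4 / 5 - (x + 4 / 100)) 0
            ltac:(unfold f; lra)); lra.
        - unfold f in *;
          assert (E2 := Hmove x (4 / 5 - x) ltac:(lra) ltac:(lra) ltac:(lra)); lra. }
      intros x Hx; destruct (Rlt_or_le x (1949 / 5000)) as [Hc|Hc];
        [apply Hfar; lra|].
      destruct (Rlt_or_le x (411 / 1000)) as [Hc2|Hc2].
      - assert (E := Hmove (x - 3 / 100) x ltac:(lra) ltac:(lra) ltac:(lra)).
        rewrite Hfar in E by lra; lra.
      - assert (E := diff_sym x (f - x) 0 ltac:(simpl; lra)).
        rewrite (Hfar (f - x)) in E by (unfold f; lra); lra. }
    assert (H36 : d (269 / 800) = 0).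
    { assert (E : d (51 / 800) + d (269 / 800) + d (2 / 5) = 0)
        by sum_zero 3%nat 36%nat 37%nat 0%Z (51 / 800) (269 / 800) (2 / 5).
      rewrite H3, (H37 (2 / 5)) in E by (unfold x2; lra); lra. }
    assert (Hseed : forall i, In i seeds -> vanishes (face_at i)).
    { assert (H0 := diff_zero).
      assert (H4 : d x2 = 0) by (apply H3; unfold x2; lra).
      intros i Hi; unfold seeds in Hi.
      repeat (destruct Hi as [<-|Hi]); [..|contradiction].
      - seed_point 0.
      - seed_open H1.
      - seed_point (101 / 5000).
      - seed_open H3.
      - seed_point x2.
      - seed_point (19 / 100).
      - seed_point a2.
      - seed_point a3.
      - seed_point (269 / 800).
      - seed_open H37.
      - seed_point (4101 / 5000).
      - seed_open diff_zero_right.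
      - seed_open H81. }
    intros HF; unfold seed_faces in HF; apply in_flat_map in HF.
    destruct HF as (i & Hi & [<-|[<-|[]]]); [|apply vanishes_mirror]; now apply Hseed.
  Qed.

  Lemma step_vanishes K a b c w :
    (a < 82)%nat -> (b < 82)%nat -> (c < 82)%nat ->
    (forall F, In F K -> vanishes F) -> step_ok K (a, b, c, w) = true ->
    vanishes (face_at c).
  Proof.
    intros Ha Hb Hc HK H z Hz; unfold step_ok in H.
    rewrite !andb_true_iff in H.
    destruct H as [[[[[[KA KB] Hp] Ho] Htt] Hl] Hh].
    assert (Hknown : forall i, known K i = true -> vanishes (face_at i)).
    { intros i Hi; apply existsb_exists in Hi; destruct Hi as (F & HF & He).
      apply face_eqb_eq in He; rewrite He; now apply HK. }
    apply num_eqb_eq in Hp; apply negb_true_iff in Ho.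
    set (x := val (lo (face_at a)) / IZR xden).
    assert (Hx : IZR xden * x = val (lo (face_at a))) by (unfold x, xden; field).
    assert (Hax : in_face (face_at a) x)
      by (unfold in_face; rewrite Ho, <- Hp, Hx; lra).
    set (y := f + IZR w - x - z).
    assert (Hby : in_face (face_at b) y).
    { assert (Hy : IZR xden * y = IZR xden * (f + IZR w) - val (lo (face_at a)) - IZR xden * z)
        by (rewrite <- Hx; unfold y; ring).
      unfold in_face in *; rewrite Hy.
      destruct (is_open (face_at b)), (is_open (face_at c)); cbn [negb andb] in Hl, Hh;
        (apply nonneg_sound in Hl || apply pos_sound in Hl);
        (apply nonneg_sound in Hh || apply pos_sound in Hh);
        rewrite !val_sub, val_target_at in Hl, Hh; lra. }
    assert (E := diff_tight_at a b c w x y z Htt Ha Hb Hc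
      ltac:(unfold y; ring) Hax Hby Hz).
    rewrite (Hknown a KA x Hax), (Hknown b KB y Hby) in E; lra.
  Qed.

  Lemma run_vanishes l K :
    (forall a b c w, In (a, b, c, w) l -> (a < 82 /\ b < 82 /\ c < 82)%nat) ->
    (forall F, In F K -> vanishes F) -> forall F, In F (run l K) -> vanishes F.
  Proof.
    revert K; induction l as [|[[[a b] c] w] l IH]; intros K Hl HK; [assumption|].
    cbn [run]; destruct (step_ok K (a, b, c, w)) eqn:Hs; [|now intros].
    apply IH; [intros; eapply Hl; right; eassumption|]; cbn [fst snd].
    destruct (Hl a b c w) as (La & Lb & Lc); [now left|].
    assert (Hc := step_vanishes K a b c w La Lb Lc HK Hs).
    intros F [<-|[<-|HF]]; [assumption|now apply vanishes_mirror|now apply HK].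
  Qed.

  (** The recorded steps reach every face except the two special ones. *)
  Lemma diff_off F x : In F faces -> in_face F x -> special F = false -> d x = 0.
  Proof.
    intros HF Hx Hs; assert (H := steps_cover).
    rewrite forallb_forall in H; specialize (H F HF); rewrite Hs in H; cbn [orb] in H.
    apply existsb_exists in H; destruct H as (G & HG & He); apply face_eqb_eq in He.
    subst G; revert x Hx; apply (run_vanishes steps seed_faces); [|apply seeds_vanish|exact HG].
    intros a b c w Hin; unfold steps in Hin.
    repeat (destruct Hin as [[= <- <- <- <-]|Hin]; [lia|]); contradiction.
  Qed.

  Lemma diff_anchor a y z :
    anchor a -> in_L y -> in_L z -> a + y + z = f -> d y + d z = 0.
  Proof.
    intros Ha Hy Hz Hs.
    assert (K := pi_fun_anchor a y z Ha Hy Hz Hs).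
    assert (K' := dominated_triple pi_fun g Ht a y z 0 ltac:(simpl; lra) K).
    destruct (anchor_face a Ha) as (F & HF & Hin).
    assert (C := anchor_check); rewrite forallb_forall in C; specialize (C F HF).
    apply andb_true_iff in C; destruct C as [C _]; apply negb_true_iff in C.
    assert (Z0 := diff_off F a (anchor_faces_incl F HF) Hin C).
    unfold d in *; lra.
  Qed.

  (** The composition of the reflections at [a] and at 19/100. *)
  Lemma diff_anchor_shift a x :
    anchor a -> in_L x -> in_L (x + (a - 19 / 100)) -> d (x + (a - 19 / 100)) = d x.
  Proof.
    intros Ha Hx Hx'.
    set (z := 61 / 100 - (x + (a - 19 / 100))).
    assert (Hz : in_L z) by (unfold z, in_L in *; lra).
    assert (E1 := diff_anchor a x z Ha Hx Hz ltac:(unfold z, f; lra)).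
    assert (E2 := diff_anchor (19 / 100) (x + (a - 19 / 100)) z ltac:(now left) Hx' Hz
      ltac:(unfold z, f; lra)); lra.
  Qed.

  (** The translation by [m p + n q] is a sequence of [|m| + |n|] single
      translations that must not leave [L]. If [m] and [n] have the same sign,
      any order works. Otherwise, as [p + q] is less than the length of [L], at
      least one of the two possible first moves stays inside. *)
  Lemma diff_lattice x t : lattice t -> in_L x -> in_L (x + t) -> d (x + t) = d x.
  Proof.
    intros (m & n & ->).
    set (p := 77 / 7752 * sqrt 2); set (q := 77 / 2584).
    assert (Hp : 1 / 100 < p < 3 / 200) by (unfold p; pose proof sqrt2_bounds; lra).
    assert (Hq : 29 / 1000 < q < 3 / 100) by (unfold q; lra).
    assert (Sp : forall x, in_L x -> in_L (x + p) -> d (x + p) = d x).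
    { intros y H1 H2.
      replace (y + p) with (y + (19 / 100 + p - 19 / 100)) by ring.
      apply diff_anchor_shift; [right; left; reflexivity|assumption|].
      replace (y + (19 / 100 + p - 19 / 100)) with (y + p) by ring; assumption. }
    assert (Sq : forall x, in_L x -> in_L (x + q) -> d (x + q) = d x).
    { intros y H1 H2.
      replace (y + q) with (y + (19 / 100 + q - 19 / 100)) by ring.
      apply diff_anchor_shift; [right; right; reflexivity|assumption|].
      replace (y + (19 / 100 + q - 19 / 100)) with (y + q) by ring; assumption. }
    clearbody p q.
    remember (Z.abs_nat m + Z.abs_nat n)%nat as k eqn:Hk.
    revert m n x Hk; induction k as [k IH] using lt_wf_ind; intros m n x -> Hx Hx'.
    assert (Up : forall m n, (0 <= m)%Z -> (0 <= n)%Z -> 0 <= IZR m * p + IZR n * q).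
    { intros m' n' Hm Hn; apply IZR_le in Hm, Hn.
      apply Rplus_le_le_0_compat; apply Rmult_le_pos; lra. }
    (* Induction on the number of moves: the first one leads to [y]. *)
    assert (Move : forall m' n' y, (Z.abs_nat m' + Z.abs_nat n' < Z.abs_nat m + Z.abs_nat n)%nat ->
              in_L y -> d y = d x ->
              y + (IZR m' * p + IZR n' * q) = x + (IZR m * p + IZR n * q) ->
              d (x + (IZR m * p + IZR n * q)) = d x).
    { intros m' n' y Hlt Hy Hd He; rewrite <- He, <- Hd.
      apply (IH _ Hlt m' n' y eq_refl Hy); now rewrite He. }
    assert (Pp : in_L (x + p) -> (0 < m)%Z -> d (x + (IZR m * p + IZR n * q)) = d x).
    { intros Hy Hm; apply (Move (m - 1)%Z n (x + p)); [lia|assumption|now apply Sp|].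
      rewrite minus_IZR; ring. }
    assert (Pm : in_L (x - p) -> (m < 0)%Z -> d (x + (IZR m * p + IZR n * q)) = d x).
    { intros Hy Hm; apply (Move (m + 1)%Z n (x - p)); [lia|assumption| |].
      - rewrite <- (Sp (x - p)) by (try replace (x - p + p) with x by ring; assumption).
        f_equal; ring.
      - rewrite plus_IZR; ring. }
    assert (Qp : in_L (x + q) -> (0 < n)%Z -> d (x + (IZR m * p + IZR n * q)) = d x).
    { intros Hy Hm; apply (Move m (n - 1)%Z (x + q)); [lia|assumption|now apply Sq|].
      rewrite minus_IZR; ring. }
    assert (Qm : in_L (x - q) -> (n < 0)%Z -> d (x + (IZR m * p + IZR n * q)) = d x).
    { intros Hy Hm; apply (Move m (n + 1)%Z (x - q)); [lia|assumption| |].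
      - rewrite <- (Sq (x - q)) by (try replace (x - q + q) with x by ring; assumption).
        f_equal; ring.
      - rewrite plus_IZR; ring. }
    unfold in_L in *.
    destruct (Z.lt_trichotomy m 0) as [Hm|[Hm|Hm]];
      destruct (Z.lt_trichotomy n 0) as [Hn|[Hn|Hn]].
    - assert (U := Up (- m - 1)%Z (- n)%Z ltac:(lia) ltac:(lia)).
      rewrite !minus_IZR, !opp_IZR in U; apply Pm; [lra|assumption].
    - assert (U := Up (- m - 1)%Z (- n)%Z ltac:(lia) ltac:(lia)).
      rewrite !minus_IZR, !opp_IZR in U; apply Pm; [lra|assumption].
    - destruct (Rlt_or_le (219 / 800) (x - p)); [apply Pm|apply Qp]; try assumption; lra.
    - assert (U := Up (- m)%Z (- n - 1)%Z ltac:(lia) ltac:(lia)).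
      rewrite !minus_IZR, !opp_IZR in U; apply Qm; [lra|assumption].
    - subst; f_equal; ring.
    - assert (U := Up m (n - 1)%Z ltac:(lia) ltac:(lia)).
      rewrite !minus_IZR in U; apply Qp; [lra|assumption].
    - destruct (Rlt_or_le (219 / 800) (x - q)); [apply Qm|apply Pp]; try assumption; lra.
    - assert (U := Up (m - 1)%Z n ltac:(lia) ltac:(lia)).
      rewrite !minus_IZR in U; apply Pp; [lra|assumption].
    - assert (U := Up (m - 1)%Z n ltac:(lia) ltac:(lia)).
      rewrite !minus_IZR in U; apply Pp; [lra|assumption].
  Qed.

  (** The triple [x, 421/800, 9/5 - 421/800 - x] has slack [slack_unit + (c2 -
      c3) * (x - 29395/100000)], and [c2 - c3 < 6]. *)
  Lemma diff_lower_at x : in_L x -> 29395 / 100000 < x ->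
    - slack_unit - 6 * (x - 29395 / 100000) <= d x.
  Proof.
    intros Hx Hx'.
    assert (Hmin := min_triple g Hg x (421 / 800) (9 / 5 - 421 / 800 - x) 1 ltac:(unfold f; lra)).
    unfold in_L in Hx.
    assert (H35 : in_face (face_at 35) x) by face_lra.
    assert (H72 : in_face (face_at 72) (421 / 800)) by face_lra.
    assert (H79 : in_face (face_at 79) (9 / 5 - 421 / 800 - x)) by face_lra.
    assert (Z1 := diff_off (face_at 72) _ (face_at_face 72 ltac:(lia)) H72 eq_refl).
    assert (Z2 := diff_off (face_at 79) _ (face_at_face 79 ltac:(lia)) H79 eq_refl).
    assert (P1 := pi_fun_face _ _ (face_at_face 35 ltac:(lia)) H35).
    assert (P2 := pi_fun_face _ _ (face_at_face 72 ltac:(lia)) H72).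
    assert (P3 := pi_fun_face _ _ (face_at_face 79 ltac:(lia)) H79).
    assert (S : pi_fun x + pi_fun (421 / 800) + pi_fun (9 / 5 - 421 / 800 - x)
                <= 1 + slack_unit + 6 * (x - 29395 / 100000)).
    { rewrite P1, P2, P3; unfold fval.
      repeat match goal with |- context [face_at ?i] =>
        let G := eval vm_compute in (face_at i) in change (face_at i) with G end.
      cbn [fconst fslope]; unfold val, xden, sden, slack_unit; cbn [fst snd]; lra. }
    unfold d in *; lra.
  Qed.

  (** By density a lattice translate of [x] lies just to the right of
      29395/100000, where [diff_lower_at] is almost sharp. *)
  Lemma diff_lower x : in_L x -> - slack_unit <= d x.
  Proof.
    intros Hx; apply Rnot_lt_le; intros Hlt.
    set (eta := Rmin (- slack_unit - d x) (1 / 10)).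
    assert (He : 0 < eta <= 1 / 10 /\ eta <= - slack_unit - d x).
    { unfold eta; split; [split|]; [apply Rmin_glb_lt; lra|apply Rmin_r|apply Rmin_l]. }
    clearbody eta.
    destruct (lattice_dense (29395 / 100000 - x) (29395 / 100000 + eta / 6 - x))
      as (t & Hlat & Ht1 & Ht2); [lra|].
    assert (HL : in_L (x + t)) by (unfold in_L in *; lra).
    assert (E := diff_lattice x t Hlat Hx HL).
    assert (E' := diff_lower_at (x + t) HL ltac:(lra)); lra.
  Qed.

  (** The reflection at 19/100 maps [L] onto itself and changes the sign of [d],
      so the lower bound is an upper bound too. *)
  Lemma diff_L_bound x : in_L x -> Rabs (d x) <= slack_unit.
  Proof.
    intros Hx; assert (K := diff_lower x Hx).
    assert (Hz : in_L (61 / 100 - x)) by (unfold in_L in *; lra).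
    assert (K' := diff_lower _ Hz).
    assert (E := diff_anchor (19 / 100) x (61 / 100 - x) ltac:(now left) Hx Hz
      ltac:(unfold f; lra)).
    apply Rabs_le; lra.
  Qed.

  Lemma diff_perturbation : perturbation d.
  Proof.
    split; [apply diff_shift| |apply diff_off|apply diff_sym|apply diff_anchor].
    intros x; replace (d x) with (d (frac_part x)).
    2: { replace (frac_part x) with (x + IZR (- Int_part x)); [apply diff_shift|].
         unfold frac_part; rewrite opp_IZR; ring. }
    destruct (faces_cover x) as (F & HF & Hx & _).
    destruct (special F) eqn:Hs.
    - apply (special_faces F _ HF Hx) in Hs; destruct Hs as [Hs|Hs];
        [now apply diff_L_bound|].
      assert (E := diff_sym (frac_part x) (f - frac_part x) 0 ltac:(simpl; lra)).
      replace (d (frac_part x)) with (- d (f - frac_part x)) by lra.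
      rewrite Rabs_Ropp; now apply diff_L_bound.
    - rewrite (diff_off F _ HF Hx Hs), Rabs_R0; unfold slack_unit; lra.
  Qed.

  (** A triple with special points that is not linked has more slack than [d]
      can use up; without special points [d] is zero; linked triples are tight
      for both functions. *)
  Lemma tight_reflected x y z k : x + y + z = f + IZR k ->
    g x + g y + g z = 1 -> pi_fun x + pi_fun y + pi_fun z = 1.
  Proof.
    intros Hk H1; assert (Hp := diff_perturbation).
    destruct (triple_cases x y z k Hk)
      as (F & G & H & (HF & Hx & Ex) & (HG & Hy & Ey) & (HH & Hz & Ez) & [Hr|Hl]).
    - assert (KF := pert_face_bound d F _ Hp HF Hx).
      assert (KG := pert_face_bound d G _ Hp HG Hy).
      assert (KH := pert_face_bound d H _ Hp HH Hz).
      rewrite pert_frac in KF, KG, KH by assumption.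
      unfold roomy in Hr; rewrite <- Ex, <- Ey, <- Ez in Hr.
      assert (K1 := Rle_abs (- d x)); rewrite Rabs_Ropp in K1.
      assert (K2 := Rle_abs (- d y)); rewrite Rabs_Ropp in K2.
      assert (K3 := Rle_abs (- d z)); rewrite Rabs_Ropp in K3.
      assert (K4 := Rle_abs (d x)); assert (K5 := Rle_abs (d y)); assert (K6 := Rle_abs (d z)).
      assert (Hd : g x + g y + g z = pi_fun x + pi_fun y + pi_fun z + (d x + d y + d z))
        by (unfold d; ring).
      destruct Hr as [_ Hr]; unfold special_count in Hr.
      destruct (Z.eq_dec (Z.b2z (special F) + Z.b2z (special G) + Z.b2z (special H)) 0)
        as [H0|H0].
      + destruct (special F), (special G), (special H); simpl in H0; try lia.
        simpl in KF, KG, KH; lra.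
      + specialize (Hr H0); rewrite !plus_IZR in Hr; lra.
    - destruct (frac_part_sum x y z k Hk) as (k' & Hk').
      assert (K' := pi_fun_linked _ _ _ k' Hk' Hl).
      rewrite !pi_fun_frac in K'; exact K'.
  Qed.
End Difference.

Lemma pi_fun_weak_facet : weak_facet pi_fun.
Proof.
  split; [apply minimal_valid, pi_fun_minimal|].
  intros g Hv Ht y; split; [apply Ht|].
  apply tight_transfer; [apply pi_fun_minimal| |].
  - now apply (dominated_minimal pi_fun g pi_fun_minimal).
  - intros x u z k; now apply tight_reflected.
Qed.

(** * Discontinuities, pieces and an irrational breakpoint *)

Lemma not_filterlim_within (P : R -> Prop) (g : R -> R) l c : 0 < c ->
  (forall eps, 0 < eps -> exists x, P x /\ Rabs x < eps /\ c <= Rabs (g x - l)) ->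
  ~ filterlim g (within P (locally 0)) (locally l).
Proof.
  intros Hc H Hlim.
  destruct (Hlim (fun y => Rabs (y - l) < c)) as [eps He].
  - exists (mkposreal c Hc); intros y Hy; exact Hy.
  - destruct (H eps (cond_pos eps)) as (x & Px & Hx & Hg).
    assert (Hball : ball 0 eps x).
    { change (Rabs (x + - 0) < eps); now rewrite Ropp_0, Rplus_0_r. }
    exact (Rlt_not_le _ _ (He x Hball Px) Hg).
Qed.

Ltac pi_value i H :=
  rewrite (pi_fun_face _ _ (face_at_face i ltac:(lia)) H); unfold fval;
  match goal with |- context [face_at i] =>
    let G := eval vm_compute in (face_at i) in change (face_at i) with G end;
  cbn [fconst fslope]; unfold val, xden, sden; cbn [fst snd].

Lemma pi_fun_discontinuous : two_sided_discontinuous pi_fun.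
Proof.
  split; apply (not_filterlim_within _ _ _ (1 / 100)); try lra; intros eps He;
    rewrite pi_fun_0; set (e := Rmin eps (1 / 100) / 2);
    assert (K : 0 < e < eps /\ e < 1 / 100)
      by (unfold e, Rmin; destruct Rle_dec; lra);
    clearbody e.
  - exists (- e); repeat split; [lra|rewrite Rabs_Ropp, Rabs_pos_eq; lra|].
    rewrite <- (pi_fun_shift (- e) 1).
    assert (H : in_face (face_at 81) (- e + IZR 1)) by face_lra.
    rewrite Rabs_pos_eq; pi_value 81%nat H; lra.
  - exists e; repeat split; [lra|rewrite Rabs_pos_eq; lra|].
    assert (H : in_face (face_at 1) e) by face_lra.
    rewrite Rabs_pos_eq; pi_value 1%nat H; lra.
Qed.

(** The breakpoint number 5 of the left table, where the value exceeds both one-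
    sided limits. *)
Definition spike : R := 77 / 7752 * sqrt 2 + 849 / 5000.

Lemma spike_irrational : irrational spike.
Proof.
  intros (p & q & Hq & H).
  assert (Hq' : IZR q <> 0) by (now apply not_0_IZR).
  assert (K : IZR q * spike = IZR p) by (rewrite H; field; assumption).
  destruct (sqrt2_free (849 * 7752 * q - 7752 * 5000 * p) (77 * 5000 * q)) as [_ K2];
    [|lia].
  rewrite minus_IZR, !mult_IZR; unfold spike in K; lra.
Qed.

Lemma Rbar_lt_near (a : Rbar) (x : R) : Rbar_lt a x ->
  exists e, 0 < e /\ forall y, x - e < y -> Rbar_lt a y.
Proof.
  destruct a as [a| |]; simpl; intros H; [|contradiction|].
  - exists (x - a); split; [lra|intros; lra].
  - exists 1; split; [lra|trivial].
Qed.

Lemma Rbar_gt_near (b : Rbar) (x : R) : Rbar_lt x b ->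
  exists e, 0 < e /\ forall y, y < x + e -> Rbar_lt y b.
Proof.
  destruct b as [b| |]; simpl; intros H; [| |contradiction].
  - exists (b - x); split; [lra|intros; lra].
  - exists 1; split; [lra|trivial].
Qed.

(** In the interior of a piece, [g x] would be the mean of [g (x - e)] and [g (x
    + e)]. *)
Lemma breakpoint_of_spike g x e0 : 0 < e0 ->
  (forall e, 0 < e < e0 -> g (x - e) + g (x + e) <> 2 * g x) -> breakpoint g x.
Proof.
  intros He0 Hne C HC; destruct (pieces_cover _ _ HC x) as ([a b] & HI & Hl & Hu).
  exists (a, b); split; [assumption|]; unfold is_endpoint; cbn [fst snd] in *.
  apply Rbar_le_lt_or_eq_dec in Hl, Hu.
  destruct Hl as [Hl|Hl]; [|now left]; destruct Hu as [Hu|Hu]; [exfalso|now right].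
  destruct (pieces_affine _ _ HC _ HI) as (m & c & Hmc).
  destruct (Rbar_lt_near a x Hl) as (e1 & He1 & K1).
  destruct (Rbar_gt_near b x Hu) as (e2 & He2 & K2).
  set (e := Rmin e0 (Rmin e1 e2) / 2).
  assert (He : 0 < e < e0 /\ e < e1 /\ e < e2).
  { unfold e, Rmin; repeat destruct Rle_dec; lra. }
  apply (Hne e ltac:(lra)).
  rewrite !Hmc; [ring| | |]; split; simpl; (apply K1 || apply K2); lra.
Qed.

Lemma spike_breakpoint : breakpoint pi_fun spike.
Proof.
  apply breakpoint_of_spike with (1 / 1000); [lra|]; intros e He.
  assert (H9 : in_face (face_at 9) (spike - e)) by (unfold spike; face_lra).
  assert (H10 : in_face (face_at 10) spike) by (unfold spike; face_lra).
  assert (H11 : in_face (face_at 11) (spike + e)) by (unfold spike; face_lra).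
  pose proof sqrt2_bounds.
  assert (V9 : pi_fun (spike - e) < 43 / 100) by (pi_value 9%nat H9; unfold spike; lra).
  assert (V10 : 44 / 100 < pi_fun spike) by (pi_value 10%nat H10; unfold spike; lra).
  assert (V11 : pi_fun (spike + e) < 43 / 100) by (pi_value 11%nat H11; unfold spike; lra).
  lra.
Qed.

Definition tile (F : face) (n : Z) : Rbar * Rbar :=
  (Finite (val (lo F) / IZR xden + IZR n), Finite (val (hi F) / IZR xden + IZR n)).

Definition tiles (I : Rbar * Rbar) : Prop :=
  exists F n, In F faces /\ is_open F = true /\ I = tile F n.

Lemma tiles_check :
  forallb (fun F => if is_open F
    then pos (nsub (hi F) (lo F)) && nonneg (lo F) && nonneg (nsub (rat 1) (hi F))
      && forallb (fun G => if is_open G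
           then num_eqb (lo F) (lo G) && num_eqb (hi F) (hi G)
                || nonneg (nsub (lo G) (hi F)) || nonneg (nsub (lo F) (hi G))
           else true) faces
    else num_eqb (lo F) (hi F) &&
      existsb (fun G => is_open G && num_eqb (lo F) (lo G)) faces) faces = true.
Proof. vm_compute; reflexivity. Qed.

Lemma open_face_bounds F : In F faces -> is_open F = true ->
  0 <= val (lo F) / IZR xden /\ val (lo F) / IZR xden < val (hi F) / IZR xden /\
  val (hi F) / IZR xden <= 1.
Proof.
  intros HF Ho; assert (H := tiles_check).
  rewrite forallb_forall in H; specialize (H F HF); rewrite Ho, !andb_true_iff in H.
  destruct H as [[[Hp Hl] Hh] _].
  apply pos_sound in Hp; apply nonneg_sound in Hl, Hh; rewrite val_sub in Hp, Hh.
  assert (H1 : val (rat 1) = IZR xden) by num_lra; rewrite H1 in Hh.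
  unfold xden in *; lra.
Qed.

Lemma open_faces_ordered F G :
  In F faces -> In G faces -> is_open F = true -> is_open G = true ->
  (forall n, tile F n = tile G n)
  \/ val (hi F) / IZR xden <= val (lo G) / IZR xden
  \/ val (hi G) / IZR xden <= val (lo F) / IZR xden.
Proof.
  intros HF HG HoF HoG; assert (H := tiles_check).
  rewrite forallb_forall in H; specialize (H F HF); rewrite HoF, !andb_true_iff in H.
  destruct H as [_ H]; rewrite forallb_forall in H; specialize (H G HG).
  rewrite HoG, !orb_true_iff, andb_true_iff in H; destruct H as [[[H1 H2]|H]|H].
  - left; intros n; apply num_eqb_eq in H1, H2; unfold tile; now rewrite H1, H2.
  - right; left; apply nonneg_sound in H; rewrite val_sub in H; unfold xden; lra.
  - right; right; apply nonneg_sound in H; rewrite val_sub in H; unfold xden; lra.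
Qed.

Lemma tiles_touch F G n m x :
  In F faces -> In G faces -> is_open F = true -> is_open G = true ->
  tile F n <> tile G m -> in_itv (tile F n) x -> in_itv (tile G m) x ->
  is_endpoint (tile F n) x /\ is_endpoint (tile G m) x.
Proof.
  intros HF HG HoF HoG Hne [X1 X2] [Y1 Y2]; unfold is_endpoint, tile in *; simpl in *.
  assert (BF := open_face_bounds F HF HoF); assert (BG := open_face_bounds G HG HoG).
  destruct (Z.lt_trichotomy n m) as [Hnm|[<-|Hnm]].
  - assert (K : IZR (n + 1) <= IZR m) by (apply IZR_le; lia); rewrite plus_IZR in K.
    split; [right|left]; f_equal; lra.
  - destruct (open_faces_ordered F G HF HG HoF HoG) as [He|[He|He]].
    + exfalso; apply Hne; exact (He n).
    + split; [right|left]; f_equal; lra.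
    + split; [left|right]; f_equal; lra.
  - assert (K : IZR (m + 1) <= IZR n) by (apply IZR_le; lia); rewrite plus_IZR in K.
    split; [left|right]; f_equal; lra.
Qed.

Lemma pi_fun_piecewise_linear : piecewise_linear pi_fun.
Proof.
  exists tiles; split.
  - intros I (F & n & HF & Ho & ->); assert (B := open_face_bounds F HF Ho); simpl; lra.
  - intros x; exists (mkposreal 1 Rlt_0_1).
    exists (flat_map (fun n => map (fun F => tile F n) faces)
              [Int_part x - 1; Int_part x; Int_part x + 1]%Z).
    intros I (F & n & HF & Ho & ->) (z & [Z1 Z2] & Hz); simpl in Z1, Z2, Hz.
    assert (B := open_face_bounds F HF Ho); apply Rabs_def2 in Hz.
    destruct (base_fp x) as [X0 X1]; unfold frac_part in X0, X1.
    apply in_flat_map; exists n; split; [|now apply (in_map (fun F => tile F n))].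
    assert (K1 : IZR (Int_part x - 2) < IZR n) by (rewrite minus_IZR; lra).
    assert (K2 : IZR n < IZR (Int_part x + 2)) by (rewrite plus_IZR; lra).
    apply lt_IZR in K1, K2; simpl; lia.
  - intros x; destruct (faces_cover x) as (F & HF & Hx & _).
    assert (HG : exists G, In G faces /\ is_open G = true /\
      val (lo G) <= IZR xden * frac_part x <= val (hi G)).
    { unfold in_face in Hx; destruct (is_open F) eqn:Ho; [exists F; repeat split; auto; lra|].
      assert (H := tiles_check).
      rewrite forallb_forall in H; specialize (H F HF); rewrite Ho, andb_true_iff in H.
      destruct H as [H1 H2]; apply num_eqb_eq in H1.
      apply existsb_exists in H2; destruct H2 as (G & HG & H2).
      apply andb_true_iff in H2; destruct H2 as [HoG H2]; apply num_eqb_eq in H2.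
      exists G; split; [exact HG|]; split; [exact HoG|].
      rewrite <- H1 in Hx; rewrite <- H2.
      assert (B := open_face_bounds G HG HoG); rewrite <- H2 in B.
      unfold xden in *; lra. }
    destruct HG as (G & HG & Ho & Hb).
    exists (tile G (Int_part x)); split; [exists G, (Int_part x); auto|].
    unfold frac_part in Hb; unfold in_itv, tile; simpl; unfold xden in *; lra.
  - intros I J (F & n & HF & HoF & ->) (G & m & HG & HoG & ->) Hne x.
    now apply tiles_touch.
  - intros I (F & n & HF & Ho & ->).
    exists (IZR (fslope F) / IZR sden),
      (val (fconst F) / (IZR xden * IZR sden) - IZR (fslope F) / IZR sden * IZR n).
    intros x [X1 X2]; simpl in X1, X2.
    replace (pi_fun x) with (pi_fun (x - IZR n)).
    2: { rewrite <- (pi_fun_shift (x - IZR n) n); f_equal; ring. }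
    rewrite (pi_fun_face F); [|assumption|].
    + unfold fval; field; unfold xden, sden; lra.
    + unfold in_face; rewrite Ho; unfold xden in *; lra.
Qed.

Theorem theorem6p2 :
  two_sided_discontinuous pi_fun /\
  piecewise_linear pi_fun /\
  (exists x : R, breakpoint pi_fun x /\ irrational x) /\
  ~ extreme pi_fun /\
  ~ facet pi_fun /\
  weak_facet pi_fun.
Proof.
  split; [exact pi_fun_discontinuous|].
  split; [exact pi_fun_piecewise_linear|].
  split; [exists spike; split; [exact spike_breakpoint|exact spike_irrational]|].
  split; [exact pi_fun_not_extreme|].
  split; [intros H; apply pi_fun_not_extreme, facet_extreme, H|].
  exact pi_fun_weak_facet.
Qed.
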